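(* Let $\{(\mathcal{C}^k,\mathcal{G}_t^k,\mathcal{H}_t^k)\}_{k\ge 0}$ ($t=1,2,3$), with multipliers $\mathcal{M}_t^k,\mathcal{V}_t^k$, be generated by the JLRST algorithm (the ADMM iteration described in the context, run indefinitely). Assume that for $t=1,2,3$ the successive differences of the multipliers satisfy $\mathcal{M}_t^{k+1}-\mathcal{M}_t^{k}\to\mathcal{O}$ and $\mathcal{V}_t^{k+1}-\mathcal{V}_t^{k}\to\mathcal{O}$ as $k\to\infty$, and that all the variables (the sequences $\mathcal{C}^k,\mathcal{G}_t^k,\mathcal{H}_t^k,\mathcal{M}_t^k,\mathcal{V}_t^k$, $t=1,2,3$) are bounded. Then there exists a subsequence of the iterates whose accumulation point $(\mathcal{C}^\ast,\mathcal{G}_1^\ast,\mathcal{G}_2^\ast,\mathcal{G}_3^\ast,\mathcal{H}_1^\ast,\mathcal{H}_2^\ast,\mathcal{H}_3^\ast)$ satisfies the KKT condition of the constrained problem (P) of the context; that is, there exist multipliers $\mathcal{M}_t^\ast,\mathcal{V}_t^\ast$ ($t=1,2,3$) such that $$\mathcal{O}=\mathcal{G}_t^\ast-\mathcal{C}^\ast,\qquad \mathcal{O}=\mathcal{H}_t^\ast-\nabla_t(\mathcal{G}_t^\ast),\qquad t=1,2,3,$$ $$\mathbf{O}=\mathbf{R}^T(\mathbf{R}\mathbf{C}_{(3)}^\ast\mathbf{B}\mathbf{S}-\mathbf{X}_{(3)})\mathbf{S}^T\mathbf{B}^T+\mathbf{R}^T\mathbf{F}^T(\mathbf{F}\mathbf{R}\mathbf{C}_{(3)}^\ast-\mathbf{Y}_{(3)})-\tfrac12\sum_{i=1}^{3}\mathbf{M}_{i(3)}^\ast,$$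 $$\mathcal{O}=\mathcal{M}_t^\ast-\nabla_t^T\mathcal{V}_t^\ast,\qquad \mathcal{O}\in\alpha_t\,\partial\Phi(\mathcal{H}_t^\ast)+\mathcal{V}_t^\ast,\qquad t=1,2,3,$$ where $\Phi(\mathcal{H})=\sum_{n=1}^{N}\|\mathcal{H}^n\|_{\mathrm{LTNN}}$ is the grouped logarithmic tensor nuclear norm defined in the context.
   Context: **Notation.** For a third-order real tensor $\mathcal{A}\in\mathbb{R}^{I_1\times I_2\times I_3}$, $\mathbf{A}_{(3)}\in\mathbb{R}^{I_3\times I_1I_2}$ is its mode-3 unfolding, whose columns are the mode-3 vectors $\mathcal{A}(i,j,:)$ in a fixed order; $\mathbf{M}_{i(3)}$ denotes the mode-3 unfolding of $\mathcal{M}_i$. $\|\cdot\|_F$ is the Frobenius norm; $\mathcal{O}$, $\mathbf{O}$ denote the zero tensor and zero matrix. The mode-$n$ product $\mathcal{A}\times_n\mathbf{D}$ is the tensor whose mode-$n$ unfolding is $\mathbf{D}\mathbf{A}_{(n)}$. The gradient along mode $t$ is $\nabla_t(\mathcal{A})=\mathcal{A}\times_t\mathbf{D}_{I_t}$, where $\mathbf{D}_{I_t}\in\mathbb{R}^{I_t\times I_t}$ is the row circulant matrix with first row $(-1,1,0,\dots,0)$; $\nabla_t^T$ is the transpose (adjoint) of the linear operator $\nabla_t$. **Data.** $W,H,S,w,h,s,L$ are positive integers with $L<S$. $\mathcal{X}\in\mathbb{R}^{w\times h\times S}$ and $\mathcal{Y}\in\mathbb{R}^{W\times H\times s}$ are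 given observed tensors; $\mathbf{B}\in\mathbb{R}^{WH\times WH}$ (blur), $\mathbf{S}\in\mathbb{R}^{WH\times wh}$ (spatial downsampling) and $\mathbf{F}\in\mathbb{R}^{s\times S}$ (spectral response) are given matrices. $\mathbf{R}=\mathbf{U}(:,1:L)\in\mathbb{R}^{S\times L}$, where $\mathbf{X}_{(3)}=\mathbf{U}\mathbf{\Sigma}\mathbf{V}^T$ is a singular value decomposition with singular values in decreasing order; in particular $\mathbf{R}^T\mathbf{R}=\mathbf{I}$. $\alpha_1,\alpha_2,\alpha_3\ge 0$ are regularization parameters, $\mu>0$ is a fixed penalty parameter, and $\epsilon>0$ is a fixed small constant. The tensors $\mathcal{C},\mathcal{G}_t,\mathcal{H}_t,\mathcal{M}_t,\mathcal{V}_t$ ($t=1,2,3$) all lie in $\mathbb{R}^{W\times H\times L}$. **Grouping.** The $W\times H$ spatial grid is divided into patches of size $\sqrt q\times\sqrt q$, and the patches are clustered into $N$ groups, the $n$-th containing $K_n$ patches (the clustering is computed once from $\mathcal{Y}$ and is then fixed). For $\mathcal{A}\in\mathbb{R}^{W\times H\times L}$, $\mathcal{A}^n\in\mathbb{R}^{K_n\times L\times q}$ is the tensor collecting the patches of $\mathcal{A}$ (each in $\mathbb{R}^{\sqrt q\times\sqrt q\times L}$) at the locations of group $n$: the first index is the patch number, the second is the index in $\{1,\dots,L\}$, and the third is the pixel position within the patch. **Logarithmic tensor nuclear norm.** For $\mathcal{A}\in\mathbb{R}^{I_1\times I_2\times I_3}$ let $\overline{\mathcal{A}}\in\mathbb{C}^{I_1\times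 I_2\times I_3}$ be its (unnormalized) discrete Fourier transform along the third mode. Then $$\|\mathcal{A}\|_{\mathrm{LTNN}}=\frac1{I_3}\sum_{i=1}^{I_3}\sum_{j}\log\big(\sigma_j(\overline{\mathcal{A}}(:,:,i))+\epsilon\big),$$ where $\sigma_j(\overline{\mathcal{A}}(:,:,i))$, $1\le j\le\min(I_1,I_2)$, are the singular values of the $i$-th frontal slice. Put $\Phi(\mathcal{H})=\sum_{n=1}^N\|\mathcal{H}^n\|_{\mathrm{LTNN}}$ for $\mathcal{H}\in\mathbb{R}^{W\times H\times L}$. $\partial$ denotes the limiting (Mordukhovich) subdifferential. **Problem (P).** Minimize over $\mathcal{C},\mathcal{G}_t,\mathcal{H}_t$ $$\|\mathbf{X}_{(3)}-\mathbf{R}\mathbf{C}_{(3)}\mathbf{B}\mathbf{S}\|_F^2+\|\mathbf{Y}_{(3)}-\mathbf{F}\mathbf{R}\mathbf{C}_{(3)}\|_F^2+\sum_{t=1}^3\alpha_t\Phi(\mathcal{H}_t)\quad\text{s.t. } \mathcal{G}_t=\mathcal{C},\ \mathcal{H}_t=\nabla_t(\mathcal{G}_t),\ t=1,2,3.$$ **JLRST algorithm (ADMM).** Starting from arbitrary initial tensors, iteration $k\mapsto k+1$ performs, in this order: 1. $\mathcal{C}^{k+1}=\arg\min_{\mathcal{C}}\ \|\mathbf{X}_{(3)}-\mathbf{R}\mathbf{C}_{(3)}\mathbf{B}\mathbf{S}\|_F^2+\|\mathbf{Y}_{(3)}-\mathbf{F}\mathbf{R}\mathbf{C}_{(3)}\|_F^2+\mu\sum_{t=1}^3\|\mathcal{G}_t^k-\mathcal{C}+\mathcal{M}_t^k/(2\mu)\|_F^2$.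 2. For $t=1,2,3$: $\mathcal{H}_t^{k+1}\in\arg\min_{\mathcal{H}_t}\ \mu\|\mathcal{H}_t-\nabla_t(\mathcal{G}_t^k)+\mathcal{V}_t^k/(2\mu)\|_F^2+\alpha_t\Phi(\mathcal{H}_t)$. 3. For $t=1,2,3$: $\mathcal{G}_t^{k+1}=\arg\min_{\mathcal{G}_t}\ \mu\|\mathcal{G}_t-\mathcal{C}^{k+1}+\mathcal{M}_t^k/(2\mu)\|_F^2+\mu\|\mathcal{H}_t^{k+1}-\nabla_t(\mathcal{G}_t)+\mathcal{V}_t^k/(2\mu)\|_F^2$. 4. For $t=1,2,3$: $\mathcal{V}_t^{k+1}=\mathcal{V}_t^k+2\mu(\mathcal{H}_t^{k+1}-\nabla_t(\mathcal{G}_t^{k+1}))$ and $\mathcal{M}_t^{k+1}=\mathcal{M}_t^k+2\mu(\mathcal{G}_t^{k+1}-\mathcal{C}^{k+1})$. *)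

(* Defs.v *)
From HB Require Import structures.
From mathcomp Require Import all_boot all_order all_algebra.
From mathcomp Require Import sesquilinear spectral complex.
From mathcomp Require Import all_classical all_reals all_analysis.

Set Implicit Arguments.
Unset Strict Implicit.
Unset Printing Implicit Defensive.
Import Order.TTheory GRing.Theory Num.Theory.
Import numFieldNormedType.Exports.
Local Open Scope classical_set_scope.
Local Open Scope ring_scope.

Notation tensor R a b c := {ffun 'I_a * 'I_b * 'I_c -> R}.

Definition is_argmin (R : realType) (T : Type) (f : T -> R) (x : T) : Prop :=
  forall y, f x <= f y.

Definition frobM (R : realType) m n (M : 'M[R]_(m, n)) : R :=
  Num.sqrt (\sum_i \sum_j M i j ^+ 2).

Definition innerT (R : realType) a b c (A B : tensor R a b c) : R :=
  \sum_x A x * B x.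

Definition frobT (R : realType) a b c (A : tensor R a b c) : R :=
  Num.sqrt (\sum_x A x ^+ 2).

Definition cvgT (R : realType) a b c (A : nat -> tensor R a b c)
    (l : tensor R a b c) : Prop :=
  (fun k => frobT (A k - l)) @ \oo --> (0 : R).

Definition boundedT (R : realType) a b c (A : nat -> tensor R a b c) : Prop :=
  exists K : R, forall k, frobT (A k) <= K.

(* The fibres of each unfolding are ordered by [mxvec_index], the last of the
   two remaining indices varying fastest. *)
Definition unfold1 (R : realType) a b c (A : tensor R a b c) : 'M[R]_(a, b * c) :=
  \matrix_(i < a) mxvec (\matrix_(j < b, k < c) A (i, j, k)).
Definition unfold2 (R : realType) a b c (A : tensor R a b c) : 'M[R]_(b, a * c) :=
  \matrix_(j < b) mxvec (\matrix_(i < a, k < c) A (i, j, k)).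
Definition unfold3 (R : realType) a b c (A : tensor R a b c) : 'M[R]_(c, a * b) :=
  \matrix_(k < c) mxvec (\matrix_(i < a, j < b) A (i, j, k)).

Definition fold1 (R : realType) a b c (M : 'M[R]_(a, b * c)) : tensor R a b c :=
  [ffun x => vec_mx (row x.1.1 M) x.1.2 x.2].
Definition fold2 (R : realType) a b c (M : 'M[R]_(b, a * c)) : tensor R a b c :=
  [ffun x => vec_mx (row x.1.2 M) x.1.1 x.2].
Definition fold3 (R : realType) a b c (M : 'M[R]_(c, a * b)) : tensor R a b c :=
  [ffun x => vec_mx (row x.2 M) x.1.1 x.1.2].

Definition mode1 (R : realType) a b c d (A : tensor R a b c) (D : 'M[R]_(d, a)) :
  tensor R d b c := fold1 (D *m unfold1 A).
Definition mode2 (R : realType) a b c d (A : tensor R a b c) (D : 'M[R]_(d, b)) :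
  tensor R a d c := fold2 (D *m unfold2 A).
Definition mode3 (R : realType) a b c d (A : tensor R a b c) (D : 'M[R]_(d, c)) :
  tensor R a b d := fold3 (D *m unfold3 A).

(* Row i is the first row r shifted cyclically i places to the right. *)
Definition row_circulant (R : realType) n (r : nat -> R) : 'M[R]_n :=
  \matrix_(i, j) r ((j + n - i) %% n)%N.

Definition grad_mx (R : realType) n : 'M[R]_n :=
  row_circulant n (fun k => if k == 0%N then -1 else if k == 1%N then 1 else 0).

(* The modes 1, 2, 3 are the indices 0, 1, 2 of 'I_3. *)
Definition nabla (R : realType) a b c (t : 'I_3) (A : tensor R a b c) :
    tensor R a b c :=
  match val t with
  | 0%N => mode1 A (grad_mx R a)
  | 1%N => mode2 A (grad_mx R b)
  | _ => mode3 A (grad_mx R c)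
  end.

(* The transpose of a linear operator on tensors: its entry at x is the inner
   product of its argument with the image of the x-th canonical tensor. *)
Definition adjointT (R : realType) a b c
    (f : tensor R a b c -> tensor R a b c) (V : tensor R a b c) :
    tensor R a b c :=
  [ffun x => innerT (f [ffun y => (y == x)%:R]) V].

Definition is_svd (R : realType) m n (A : 'M[R]_(m, n)) (U : 'M[R]_m)
    (Sig : 'M[R]_(m, n)) (V : 'M[R]_n) : Prop :=
  [/\ U^T *m U = 1%:M,
      V^T *m V = 1%:M,
      forall (i : 'I_m) (j : 'I_n), val i != val j -> Sig i j = 0,
      (forall (i : 'I_m) (j : 'I_n), val i = val j -> 0 <= Sig i j) /\
      (forall (i i' : 'I_m) (j j' : 'I_n), val i = val j -> val i' = val j' -> (i <= i')%N ->
         Sig i' j' <= Sig i j)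
    & A = U *m Sig *m V^T].

Definition first_cols (R : realType) m n l (hl : (l <= n)%N) (U : 'M[R]_(m, n)) :
  'M[R]_(m, l) := colsub (widen_ord hl) U.

(* The min(m, n) largest square roots of the eigenvalues of A^* A, counted with
   multiplicity, in decreasing order. *)
Definition singular_values (R : realType) m n (A : 'M[R[i]]_(m, n)) : seq R :=
  let sp := spectral_diag (map_mx Num.conj A^T *m A) in
  take (minn m n) (sort >=%R [seq Num.sqrt (complex.Re (sp 0 i)) | i <- enum 'I_n]).

Definition dft3 (R : realType) a b c (A : tensor R a b c) : tensor R[i] a b c :=
  [ffun x : 'I_a * 'I_b * 'I_c => \sum_(l < c)
     let theta := 2 * pi * (x.2 * l)%N%:R / c%:R in
     (A (x.1.1, x.1.2, l))%:C%C * Complex (cos theta) (- sin theta)].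

Definition frontal_slice (T : Type) a b c (A : tensor T a b c) (k : 'I_c) :
  'M[T]_(a, b) := \matrix_(i, j) A (i, j, k).

Definition ltnn (R : realType) (eps : R) a b c (A : tensor R a b c) : R :=
  c%:R^-1 * \sum_(k < c) \sum_(j < minn a b)
    ln ((singular_values (frontal_slice (dft3 A) k))`_j + eps).

Lemma patch_index_lt n p (a : 'I_(n %/ p)) (u : 'I_p) : (a * p + u < n)%N.
Proof.
apply: leq_trans (leq_divM n p); apply: (@leq_trans (a.+1 * p)).
  by rewrite mulSn addnC ltn_add2r.
by rewrite leq_mul2r ltn_ord orbT.
Qed.

Definition patch_index n p (a : 'I_(n %/ p)) (u : 'I_p) : 'I_n :=
  Ordinal (patch_index_lt a u).

Definition patches_of W H p N
    (cl : 'I_(W %/ p) * 'I_(H %/ p) -> 'I_N) (n : 'I_N) :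
  {set 'I_(W %/ p) * 'I_(H %/ p)} := [set P | cl P == n].

(* Patches are p x p blocks (p = sqrt q), labelled by block row and column; cl
   sends a patch to its group and pix fixes the order of the q = p * p pixels
   of a patch. *)
Definition group_tensor (R : realType) W H L p N
    (cl : 'I_(W %/ p) * 'I_(H %/ p) -> 'I_N)
    (pix : 'I_(p * p) -> 'I_p * 'I_p) (A : tensor R W H L) (n : 'I_N) :
    tensor R #|patches_of cl n| L (p * p)%N :=
  [ffun x =>
     let P := enum_val x.1.1 in
     let u := pix x.2 in
     A (patch_index P.1 u.1, patch_index P.2 u.2, x.1.2)].

Definition Phi (R : realType) (eps : R) W H L p N
    (cl : 'I_(W %/ p) * 'I_(H %/ p) -> 'I_N)
    (pix : 'I_(p * p) -> 'I_p * 'I_p) (A : tensor R W H L) : R :=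
  \sum_(n < N) ltnn eps (group_tensor cl pix A n).

Definition frechet_subdiff (R : realType) a b c (f : tensor R a b c -> R)
    (x : tensor R a b c) : set (tensor R a b c) :=
  [set v | forall eta : R, 0 < eta -> exists2 delta : R, 0 < delta &
     forall y, frobT (y - x) < delta ->
       - eta * frobT (y - x) <= f y - f x - innerT v (y - x)].

Definition limiting_subdiff (R : realType) a b c (f : tensor R a b c -> R)
    (x : tensor R a b c) : set (tensor R a b c) :=
  [set v | exists xs vs : nat -> tensor R a b c,
     [/\ cvgT xs x,
         (fun k => f (xs k)) @ \oo --> f x,
         forall k, frechet_subdiff f (xs k) (vs k)
       & cvgT vs v]].

Definition data_fit (R : realType) W H nS w h s L
    (X : tensor R w h nS) (Y : tensor R W H s)
    (B : 'M[R]_(W * H)) (Sm : 'M[R]_(W * H, w * h)) (F : 'M[R]_(s, nS))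
    (Rm : 'M[R]_(nS, L)) (C : tensor R W H L) : R :=
  frobM (unfold3 X - Rm *m unfold3 C *m B *m Sm) ^+ 2
  + frobM (unfold3 Y - F *m Rm *m unfold3 C) ^+ 2.

(* Main.v *)
Require Import Defs.
From HB Require Import structures.
From mathcomp Require Import all_boot all_order all_algebra.
From mathcomp Require Import sesquilinear spectral complex.
From mathcomp Require Import all_classical all_reals all_analysis.
From mathcomp Require Import ring lra.

Set Implicit Arguments.
Unset Strict Implicit.
Unset Printing Implicit Defensive.
Import Order.TTheory GRing.Theory Num.Theory.
Import numFieldNormedType.Exports.
Local Open Scope classical_set_scope.
Local Open Scope ring_scope.

(** The crux is that the penalty terms of the [C]-step vanish along a
    subsequence; the multiplier hypotheses give all the other limits directly.

    The updates of [M] and [V] turn the hypotheses on successive multipliers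
    into [G_t^(k+1) - C^(k+1) -> 0] and [H_t^(k+1) - nabla_t G_t^(k+1) -> 0],
    so every cluster point is feasible.  The first-order conditions of the
    [C]- and [H]-steps, however, involve [G_t^k] together with [C^(k+1)] and
    [H_t^(k+1)]: in the limit one needs [G_t^k - C^(k+1) -> 0].  Comparing the
    value of the [C]-step at its minimiser [C^(k+1)] with its value at [C^k]
    and setting
    [E_k = data_fit C^k - sum_t <C^k, M_t^k>]
    gives
    [mu sum_t |G_t^k - C^(k+1)|^2 <= E_k - E_(k+1) + o(1)]
    ([argmin_penalty_descent]).  Since [E] is bounded below, the left-hand side
    has lower limit [0] ([almost_descent_liminf0]); a subsequence along which
    it tends to [0] is refined by compactness until all iterates converge.

    The [C]- and [G]-steps are quadratic and their first-order conditions
    ([argmin_data_fit], [argmin_nabla_fit]) pass to the limit entry by entry.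
    The [H]-step is a proximal step for [alpha_t Phi].  When [alpha_t > 0] it
    exhibits a Frechet subgradient of [Phi] at [H_t^(k+1)]
    ([prox_frechet_subdiff]), and these subgradients converge to
    [- V_t / alpha_t]; continuity of [Phi] makes the limit a limiting
    subgradient.  When [alpha_t = 0] the step forces [V_t = 0], and what is left
    is that the limiting subdifferential of [Phi] is nonempty
    ([lipschitzT_limiting_subdiff_neq0]).

    Both cases rest on [Phi] being Lipschitz ([Phi_lipschitz]), which comes from
    Weyl's inequality for singular values ([singular_values_lipschitz]) and from
    [x |-> ln (x + eps)] being Lipschitz on [x >= 0]. *)

(** * Euclidean norms and inner products *)

(** Lagrange's identity: the defect is half the sum of the squares of the
    minors [f i * g j - f j * g i]. *)
Lemma sum_cauchy_schwarz (R : realType) (I : finType) (f g : I -> R) :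
  (\sum_i f i * g i) ^+ 2 <= (\sum_i f i ^+ 2) * (\sum_i g i ^+ 2).
Proof.
have : 0 <= \sum_i \sum_j (f i * g j - f j * g i) ^+ 2.
  by apply: sumr_ge0 => i _; apply: sumr_ge0 => j _; exact: sqr_ge0.
have -> : \sum_i \sum_j (f i * g j - f j * g i) ^+ 2 =
    \sum_i \sum_j (f i ^+ 2 * g j ^+ 2) + \sum_i \sum_j (g i ^+ 2 * f j ^+ 2)
    - 2 * \sum_i \sum_j ((f i * g i) * (f j * g j)).
  rewrite mulr_sumr -big_split/= -sumrB; apply: eq_bigr => i _.
  rewrite mulr_sumr -big_split/= -sumrB; apply: eq_bigr => j _.
  ring.
rewrite -!big_distrlr/= => h; lra.
Qed.

(** The Euclidean norm of a finite family; [frobT] is the case of the entries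
    of a tensor, and [cnorm] below that of the moduli of a complex vector. *)
Definition l2norm (R : realType) (I : finType) (f : I -> R) : R :=
  Num.sqrt (\sum_i f i ^+ 2).

Lemma l2norm_ge0 (R : realType) (I : finType) (f : I -> R) : 0 <= l2norm f.
Proof. exact: sqrtr_ge0. Qed.

Lemma l2norm_sqr (R : realType) (I : finType) (f : I -> R) :
  l2norm f ^+ 2 = \sum_i f i ^+ 2.
Proof. by rewrite sqr_sqrtr// sumr_ge0// => i _; exact: sqr_ge0. Qed.

Lemma l2norm_cauchy_schwarz (R : realType) (I : finType) (f g : I -> R) :
  `|\sum_i f i * g i| <= l2norm f * l2norm g.
Proof.
rewrite -(@ler_pXn2r _ 2)// ?nnegrE ?mulr_ge0 ?l2norm_ge0//.
by rewrite real_normK ?num_real// exprMn !l2norm_sqr sum_cauchy_schwarz.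
Qed.

Lemma l2normD (R : realType) (I : finType) (f g : I -> R) :
  l2norm (fun i => f i + g i) <= l2norm f + l2norm g.
Proof.
rewrite -(@ler_pXn2r _ 2)// ?nnegrE ?addr_ge0 ?l2norm_ge0//.
rewrite sqrrD !l2norm_sqr.
have -> : \sum_i (f i + g i) ^+ 2 =
    \sum_i f i ^+ 2 + 2 * (\sum_i f i * g i) + \sum_i g i ^+ 2.
  by rewrite mulr_sumr -!big_split/=; apply: eq_bigr => i _; ring.
have := le_trans (ler_norm _) (l2norm_cauchy_schwarz f g); lra.
Qed.

Lemma le_l2norm (R : realType) (I : finType) (f g : I -> R) :
  (forall i, 0 <= f i <= g i) -> l2norm f <= l2norm g.
Proof.
move=> fg; apply: ler_wsqrtr; apply: ler_sum => i _.
have /andP[f0 fgi] := fg i.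
by rewrite ler_pXn2r// nnegrE// (le_trans f0).
Qed.

Lemma innerTC (R : realType) a b c (A B : tensor R a b c) :
  innerT A B = innerT B A.
Proof. by apply: eq_bigr => x _; rewrite mulrC. Qed.

Lemma innerTDl (R : realType) a b c (A B D : tensor R a b c) :
  innerT (A + B) D = innerT A D + innerT B D.
Proof.
by rewrite /innerT -big_split/=; apply: eq_bigr => x _; rewrite ffunE mulrDl.
Qed.

Lemma innerTZl (R : realType) a b c (k : R) (A D : tensor R a b c) :
  innerT (k *: A) D = k * innerT A D.
Proof.
by rewrite /innerT mulr_sumr; apply: eq_bigr => x _; rewrite ffunE -mulrA.
Qed.

Lemma innerTNl (R : realType) a b c (A D : tensor R a b c) :
  innerT (- A) D = - innerT A D.
Proof. by rewrite -scaleN1r innerTZl mulN1r. Qed.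

Lemma innerTDr (R : realType) a b c (A B D : tensor R a b c) :
  innerT D (A + B) = innerT D A + innerT D B.
Proof. by rewrite innerTC innerTDl !(innerTC D). Qed.

Lemma innerTZr (R : realType) a b c (k : R) (A D : tensor R a b c) :
  innerT D (k *: A) = k * innerT D A.
Proof. by rewrite innerTC innerTZl (innerTC D). Qed.

Lemma innerTNr (R : realType) a b c (A D : tensor R a b c) :
  innerT D (- A) = - innerT D A.
Proof. by rewrite innerTC innerTNl (innerTC D). Qed.

Definition innerTE := (innerTDl, innerTDr, innerTZl, innerTZr, innerTNl, innerTNr).

Lemma innerT_deltal (R : realType) a b c (A : tensor R a b c) x :
  innerT [ffun y => (y == x)%:R] A = A x.
Proof.
rewrite /innerT (bigD1 x)//= ffunE eqxx mul1r big1 ?addr0// => y yx.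
by rewrite ffunE (negPf yx) mul0r.
Qed.

Lemma frobT_ge0 (R : realType) a b c (A : tensor R a b c) : 0 <= frobT A.
Proof. exact: sqrtr_ge0. Qed.

Lemma frobT_sqr (R : realType) a b c (A : tensor R a b c) :
  frobT A ^+ 2 = innerT A A.
Proof.
rewrite sqr_sqrtr; first by apply: eq_bigr => x _; rewrite expr2.
by apply: sumr_ge0 => x _; exact: sqr_ge0.
Qed.

Lemma normr_innerT_le (R : realType) a b c (A B : tensor R a b c) :
  `|innerT A B| <= frobT A * frobT B.
Proof. exact: l2norm_cauchy_schwarz. Qed.

Lemma frobTD (R : realType) a b c (A B : tensor R a b c) :
  frobT (A + B) <= frobT A + frobT B.
Proof.
apply: le_trans (l2normD A B); rewrite le_eqVlt; apply/orP; left; apply/eqP.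
by congr Num.sqrt; apply: eq_bigr => x _; rewrite ffunE.
Qed.

Lemma frobTZ (R : realType) a b c (k : R) (A : tensor R a b c) :
  frobT (k *: A) = `|k| * frobT A.
Proof.
apply/eqP; rewrite -(@eqrXn2 _ 2)// ?mulr_ge0 ?frobT_ge0//.
by rewrite exprMn real_normK ?num_real// !frobT_sqr !innerTE; apply/eqP; ring.
Qed.

Lemma frobTN (R : realType) a b c (A : tensor R a b c) :
  frobT (- A) = frobT A.
Proof. by rewrite -scaleN1r frobTZ normrN1 mul1r. Qed.

Lemma frobTB_sym (R : realType) a b c (A B : tensor R a b c) :
  frobT (A - B) = frobT (B - A).
Proof. by rewrite -frobTN opprB. Qed.

Lemma frobT0 (R : realType) a b c : frobT (0 : tensor R a b c) = 0.
Proof. by rewrite -(scale0r 0) frobTZ normr0 mul0r. Qed.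

Lemma normr_entry_le_frobT (R : realType) a b c (A : tensor R a b c) x :
  `|A x| <= frobT A.
Proof.
rewrite -(@ler_pXn2r _ 2)// ?nnegrE ?frobT_ge0// real_normK ?num_real//.
rewrite frobT_sqr /innerT (bigD1 x)//= -expr2 lerDl.
by apply: sumr_ge0 => y _; rewrite -expr2 sqr_ge0.
Qed.

Lemma frobTD_sqr (R : realType) a b c (A B : tensor R a b c) :
  frobT (A + B) ^+ 2 = frobT A ^+ 2 + 2 * innerT A B + frobT B ^+ 2.
Proof. by rewrite !frobT_sqr !innerTE (innerTC B A); ring. Qed.

Lemma frobT_line (R : realType) a b c (A D : tensor R a b c) (s : R) :
  frobT (A + s *: D) ^+ 2 =
  frobT A ^+ 2 + 2 * s * innerT A D + s ^+ 2 * frobT D ^+ 2.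
Proof. by rewrite frobTD_sqr frobTZ exprMn real_normK ?num_real// innerTZr mulrA. Qed.

(** Exchanging [A] and [B] bounds the absolute value, so the one-sided
    inequality is enough. *)
Definition lipschitzT (R : realType) a b c (f : tensor R a b c -> R) (K : R) :=
  forall A B, f A - f B <= K * frobT (A - B).

(** * Limits and compactness for sequences of tensors *)

Lemma cvg_sum_seq (R : realType) (I : Type) (r : seq I) (u : I -> nat -> R)
    (l : I -> R) :
  (forall i, u i @ \oo --> l i) ->
  (fun k => \sum_(i <- r) u i k) @ \oo --> \sum_(i <- r) l i.
Proof.
move=> ul; elim: r => [|i r ih].
  by under eq_fun do rewrite big_nil; rewrite big_nil; exact: cvg_cst.
under eq_fun do rewrite big_cons; rewrite big_cons.
exact: cvgD (ul i) ih.
Qed.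

(** Reduces limits of tensors to limits of real sequences; the norm dominates
    each entry and is a continuous function of the entries. *)
Lemma cvgTP (R : realType) a b c (A : nat -> tensor R a b c) l :
  cvgT A l <-> forall x, (fun k => A k x) @ \oo --> l x.
Proof.
split=> [Al x|Al].
  apply/subr_cvg0.
  suff : (fun k => `|(A k - l) x|) @ \oo --> (0 : R).
    by move/norm_cvg0P; under eq_fun do rewrite !ffunE.
  apply: (@squeeze_cvgr _ _ _ _ (cst 0) (fun k => frobT (A k - l))) => //.
    by near=> k; rewrite normr_ge0 normr_entry_le_frobT.
  exact: cvg_cst.
have sq0 : (fun k => \sum_x (A k - l) x ^+ 2) @ \oo --> (0 : R).
  have s0 : \sum_(x : 'I_a * 'I_b * 'I_c) (0 : R) ^+ 2 = 0.
    by rewrite big1// => x _; rewrite expr0n.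
  rewrite -[X in _ --> X]s0.
  apply: (@cvg_sum_seq R _ _ (fun x k => (A k - l) x ^+ 2)
    (fun=> 0 ^+ 2)) => x.
  under eq_fun do rewrite !ffunE expr2.
  by rewrite expr2; apply: cvgM; exact/subr_cvg0.
rewrite /cvgT -[X in _ --> X]sqrtr0.
by apply: continuous_cvg sq0; exact: sqrt_continuous.
Unshelve. all: by end_near. Qed.

Lemma subseq_ge (phi : nat -> nat) : {homo phi : i j / (i < j)%N} ->
  forall k, (k <= phi k)%N.
Proof. by move=> phi_lt; elim=> // k ih; apply: leq_ltn_trans ih (phi_lt _ _ _). Qed.

Lemma cvg_subseq (R : realType) (phi : nat -> nat) (u : nat -> R) (l : R) :
  {homo phi : i j / (i < j)%N} ->
  u @ \oo --> l -> (fun k => u (phi k)) @ \oo --> l.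
Proof.
move=> phi_lt ul; apply: (cvg_comp phi u) ul.
move=> P [N _ NP]; exists N => // k /= Nk; apply: NP => /=.
exact: leq_trans Nk (subseq_ge phi_lt k).
Qed.

Lemma cvgT_subseq (R : realType) a b c (phi : nat -> nat)
    (A : nat -> tensor R a b c) l :
  {homo phi : i j / (i < j)%N} -> cvgT A l -> cvgT (fun k => A (phi k)) l.
Proof. by move=> phi_lt /cvg_subseq; exact. Qed.

Lemma bounded_cvg_subseq (R : realType) (u : nat -> R) (K : R) :
  (forall k, `|u k| <= K) ->
  exists2 phi : nat -> nat, {homo phi : i j / (i < j)%N} &
    exists l : R, (fun k => u (phi k)) @ \oo --> l.
Proof.
move=> uK; have [|l [_ /cluster_eventually_cvg[phi phi_incr phil]]] :=
    @segment_compact R (- K) K (u @ \oo) _.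
  by exists 0%N => // k _ /=; rewrite in_itv/= -ler_norml.
exists phi => [i j ij|]; last by exists l.
by have := phi_incr j i; rewrite leEnat => e; rewrite ltnNge e -ltnNge.
Qed.

(** Successive extraction, one coordinate at a time. *)
Lemma bounded_cvg_subseq_seq (R : realType) (I : eqType) (r : seq I)
    (u : I -> nat -> R) (K : I -> R) :
  (forall i k, `|u i k| <= K i) ->
  exists2 phi : nat -> nat, {homo phi : i j / (i < j)%N} &
    forall i, i \in r -> exists l : R, (fun k => u i (phi k)) @ \oo --> l.
Proof.
move=> uK; elim: r => [|i r [phi phi_lt ih]]; first by exists id.
have [psi psi_lt [l il]] :=
  @bounded_cvg_subseq _ (fun k => u i (phi k)) (K i) (fun k => uK i (phi k)).
exists (phi \o psi) => [m n mn /=|j]; first exact/phi_lt/psi_lt.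
rewrite in_cons => /orP[/eqP ->|/ih[l' jl]]; first by exists l.
by exists l'; exact: (cvg_subseq psi_lt jl).
Qed.

(** Bolzano-Weierstrass for finitely many sequences of tensors at once, with
    a common extraction. *)
Lemma boundedT_cvg_subseq (R : realType) a b c (J : finType)
    (z : J -> nat -> tensor R a b c) :
  (forall j, boundedT (z j)) ->
  exists2 phi : nat -> nat, {homo phi : i j / (i < j)%N} &
    exists l, forall j, cvgT (fun k => z j (phi k)) (l j).
Proof.
move=> /choice[K zK].
have [phi phi_lt lim] := @bounded_cvg_subseq_seq R _
  (enum [set: J * ('I_a * 'I_b * 'I_c)]%SET) (fun i k => z i.1 k i.2)
  (fun i => K i.1)
  (fun i k => le_trans (normr_entry_le_frobT _ _) (zK i.1 k)).
exists phi => //.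
have {}lim i : exists l : R, (fun k => z i.1 (phi k) i.2) @ \oo --> l.
  by apply: lim; rewrite mem_enum inE.
have [l zl] := choice lim.
exists (fun j => [ffun x => l (j, x)]) => j; apply/cvgTP => x.
by rewrite ffunE; exact: (zl (j, x)).
Qed.

Lemma cvg0_le (R : realType) (u e : nat -> R) :
  (forall k, 0 <= u k <= e k) -> e @ \oo --> (0 : R) -> u @ \oo --> (0 : R).
Proof.
move=> ue e0; apply: (@squeeze_cvgr _ _ _ _ (cst 0) e) => //.
  by near=> k; exact: ue.
exact: cvg_cst.
Unshelve. all: by end_near. Qed.

Lemma cvg0Ml (R : realType) (c : R) (u : nat -> R) :
  u @ \oo --> (0 : R) -> (fun k => c * u k) @ \oo --> (0 : R).
Proof. by move=> u0; rewrite -(mulr0 c); apply: cvgM u0; exact: cvg_cst. Qed.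

Lemma cvg0_sqr (R : realType) (u : nat -> R) :
  u @ \oo --> (0 : R) -> (fun k => u k ^+ 2) @ \oo --> (0 : R).
Proof. by move=> u0; rewrite -(mulr0 0); exact: cvgM. Qed.

Lemma lipschitzT_cvg (R : realType) a b c (f : tensor R a b c -> R) (K : R)
    (A : nat -> tensor R a b c) l :
  lipschitzT f K -> cvgT A l -> (fun k => f (A k)) @ \oo --> f l.
Proof.
move=> fK Al; apply/subr_cvg0/norm_cvg0P.
apply: (@cvg0_le _ _ (fun k => K * frobT (A k - l))) => [k|].
  by rewrite normr_ge0 ler_norml lerNl opprB fK frobTB_sym fK.
by rewrite -(mulr0 K); apply: cvgM Al; exact: cvg_cst.
Qed.

Lemma frobTB_lipschitz (R : realType) a b c (x : tensor R a b c) :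
  lipschitzT (fun Z => frobT (Z - x)) 1.
Proof.
move=> A B; rewrite mul1r lerBlDr.
by have := frobTD (A - B) (B - x); rewrite addrA subrK.
Qed.

Lemma cvgT_unique (R : realType) a b c (A : nat -> tensor R a b c) l l' :
  cvgT A l -> cvgT A l' -> l = l'.
Proof.
move=> /cvgTP Al /cvgTP Al'; apply/ffunP => x.
exact: cvg_unique (Al x) (Al' x).
Qed.

Lemma cvgT_cst (R : realType) a b c (l : tensor R a b c) : cvgT (fun=> l) l.
Proof. by apply/cvgTP => x; exact: cvg_cst. Qed.

Lemma cvgTD (R : realType) a b c (A B : nat -> tensor R a b c) l l' :
  cvgT A l -> cvgT B l' -> cvgT (fun k => A k + B k) (l + l').
Proof.
move=> /cvgTP Al /cvgTP Bl'; apply/cvgTP => x; rewrite ffunE.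
by under eq_fun do rewrite ffunE; exact: cvgD.
Qed.

Lemma cvgTZ (R : realType) a b c (k : R) (A : nat -> tensor R a b c) l :
  cvgT A l -> cvgT (fun n => k *: A n) (k *: l).
Proof.
move=> /cvgTP Al; apply/cvgTP => x; rewrite ffunE.
by under eq_fun do rewrite ffunE; apply: cvgM => //; exact: cvg_cst.
Qed.

Lemma cvgTB (R : realType) a b c (A B : nat -> tensor R a b c) l l' :
  cvgT A l -> cvgT B l' -> cvgT (fun k => A k - B k) (l - l').
Proof.
move=> Al Bl'; rewrite -scaleN1r; under eq_fun do rewrite -scaleN1r.
exact: cvgTD Al (cvgTZ _ Bl').
Qed.

Lemma cvgT_adjointT (R : realType) a b c (f : tensor R a b c -> tensor R a b c)
    (A : nat -> tensor R a b c) l :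
  cvgT A l -> cvgT (fun k => adjointT f (A k)) (adjointT f l).
Proof.
move=> /cvgTP Al; apply/cvgTP => x; rewrite ffunE.
under eq_fun do rewrite ffunE.
apply: (@cvg_sum_seq R _ _ (fun y k => f _ y * A k y) (fun y => f _ y * l y)) => y.
by apply: cvgM => //; exact: cvg_cst.
Qed.

(** * Perturbation of singular values *)

Local Notation "M ^t*" := (map_mx Num.conj M^T) (at level 30).

(** The moduli make the Hermitian norm an instance of the real Euclidean norm,
    so that Cauchy-Schwarz and the triangle inequality are inherited. *)
Definition cnorm (R : realType) n (v : 'rV[R[i]]_n) : R :=
  l2norm (fun i => Normc.normc (v 0 i)).

Lemma normc_ge0 (R : realType) (z : R[i]) : 0 <= Normc.normc z.
Proof. by case: z => x y; exact: sqrtr_ge0. Qed.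

Lemma normc_sqrC (R : realType) (z : R[i]) :
  (Normc.normc z ^+ 2)%:C%C = z * Num.conj z.
Proof. by rewrite -normCK normc_def rmorphXn; case: z. Qed.

Lemma normc_eq0 (R : realType) (z : R[i]) : (Normc.normc z == 0) = (z == 0).
Proof.
by apply/eqP/eqP => [/Normc.eq0_normc|->]//; rewrite Normc.normc0.
Qed.

Lemma cnorm_ge0 (R : realType) n (v : 'rV[R[i]]_n) : 0 <= cnorm v.
Proof. exact: l2norm_ge0. Qed.

Lemma cnorm_sqr (R : realType) n (v : 'rV[R[i]]_n) :
  (cnorm v ^+ 2)%:C%C = (v *m v ^t*) 0 0.
Proof.
rewrite l2norm_sqr rmorph_sum mxE; apply: eq_bigr => i _.
by rewrite !mxE; exact: normc_sqrC.
Qed.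

Lemma cnormD (R : realType) n (v w : 'rV[R[i]]_n) :
  cnorm (v + w) <= cnorm v + cnorm w.
Proof.
apply: le_trans (l2normD _ _); apply: le_l2norm => i.
by rewrite normc_ge0 mxE le_normcD.
Qed.

Lemma le_normc_sum (R : realType) (I : finType) (z : I -> R[i]) :
  Normc.normc (\sum_i z i) <= \sum_i Normc.normc (z i).
Proof.
elim/big_rec2: _ => [|i y x _ h]; first by rewrite Normc.normc0.
by apply: le_trans (le_normcD _ _) _; rewrite lerD2l.
Qed.

Definition cfrob (R : realType) m n (A : 'M[R[i]]_(m, n)) : R :=
  l2norm (fun i => l2norm (fun j => Normc.normc (A i j))).

Lemma normc_conj (R : realType) (z : R[i]) :
  Normc.normc (Num.conj z) = Normc.normc z.
Proof. by case: z => x y /=; rewrite sqrrN. Qed.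

Lemma cnorm_mulmx_le (R : realType) m n (A : 'M[R[i]]_(m, n)) (v : 'rV_n) :
  cnorm (v *m A ^t*) <= cfrob A * cnorm v.
Proof.
rewrite -(@ler_pXn2r _ 2)// ?nnegrE ?mulr_ge0 ?l2norm_ge0//.
rewrite exprMn !l2norm_sqr mulr_suml; apply: ler_sum => i _.
rewrite -l2norm_sqr -exprMn ler_pXn2r ?nnegrE ?mulr_ge0 ?l2norm_ge0 ?normc_ge0//.
rewrite mxE; apply: le_trans (le_normc_sum _) _.
apply: le_trans (le_trans (ler_norm _) (l2norm_cauchy_schwarz _ _)).
apply: ler_sum => j _.
by rewrite !mxE Normc.normcM normc_conj mulrC.
Qed.

(** The squares of the singular values of [A], padded with zeros when [m < n], in
    the order in which the spectral theorem lists them. *)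
Definition gram_eigen (R : realType) m n (A : 'M[R[i]]_(m, n)) (i : 'I_n) : R :=
  complex.Re (spectral_diag (A ^t* *m A) 0 i).

(** In an orthonormal eigenbasis of [A ^t* *m A] the quadratic form
    [v |-> |v *m A ^t*|^2] is diagonal.  Row vectors act on the left, whence
    [A ^t*] where the column convention would have [A]. *)
Lemma gram_eigenE (R : realType) m n (A : 'M[R[i]]_(m, n))
    (S := A ^t* *m A) (u : 'rV_n) :
  cnorm (u *m spectralmx S *m A ^t*) ^+ 2 =
  \sum_i gram_eigen A i * Normc.normc (u 0 i) ^+ 2.
Proof.
set P := spectralmx S.
have PU : P \is unitarymx := spectral_unitarymx S.
have Sh : S ^t* = S.
  by rewrite /S trmx_mul map_mxM trmxCK.
have SE : P *m S *m P ^t* = diag_mx (spectral_diag S).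
  have /orthomx_spectralP SP : S \is normalmx by apply/normalmxP; rewrite Sh.
  rewrite {1}SP -/P !mulmxA mulmxV ?spectral_unit// mul1mx.
  by rewrite -mulmxA (unitarymxP PU) mulmx1.
have /(congr1 (@complex.Re R)) /= -> := cnorm_sqr (u *m P *m A ^t*).
have -> : u *m P *m A ^t* *m (u *m P *m A ^t*) ^t* =
    u *m diag_mx (spectral_diag S) *m u ^t*.
  by rewrite -SE /S !trmx_mul !map_mxM trmxCK !mulmxA.
rewrite mxE (raddf_sum (@complex.Re R : Rcomplex R -> R)).
apply: eq_bigr => i _.
rewrite /gram_eigen -/S mul_mx_diag !mxE mulrAC -normc_sqrC mulrC.
by case: (spectral_diag S 0 i) => x y /=; rewrite ?(mul0r, mulr0) subr0.
Qed.

Lemma cnorm_unitary (R : realType) n (P : 'M[R[i]]_n) (u : 'rV_n) :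
  P \is unitarymx -> cnorm (u *m P) = cnorm u.
Proof.
move=> PU; apply/eqP; rewrite -(@eqrXn2 _ 2)// ?cnorm_ge0//; apply/eqP.
apply: complexI; rewrite !cnorm_sqr trmx_mul map_mxM mulmxA.
by rewrite -(mulmxA u) (unitarymxP PU) mulmx1.
Qed.

Lemma gram_eigen_ge0 (R : realType) m n (A : 'M[R[i]]_(m, n)) i :
  0 <= gram_eigen A i.
Proof.
have := gram_eigenE A (delta_mx 0 i).
rewrite (bigD1 i)//= big1 => [|j ji]; last first.
  by rewrite mxE eqxx (negPf ji) Normc.normc0 expr0n mulr0.
rewrite mxE !eqxx Normc.normc1 expr1n mulr1 addr0 => e.
by rewrite -e sqr_ge0.
Qed.

(** The vectors supported in [I] form a space of dimension [#|I|], on which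
    vanishing at the indices of [J] imposes only [#|J|] linear conditions. *)
Lemma supported_vector_vanishing (F : fieldType) n (Q : 'M[F]_n) (I J : {set 'I_n}) :
  (#|J| < #|I|)%N ->
  exists u : 'rV[F]_n, [/\ u != 0, forall i, i \notin I -> u 0 i = 0 &
    forall i, i \in J -> (u *m Q) 0 i = 0].
Proof.
move=> JI.
pose EI : 'M[F]_(#|I|, n) := \matrix_(k, i) (enum_val k == i)%:R.
pose K : 'M[F]_(#|I|, #|J|) := colsub enum_val (EI *m Q).
have : kermx K != 0.
  rewrite kermx_eq0; apply/negP => /eqP rK.
  by have := rank_leq_col K; rewrite rK leqNgt JI.
move=> /rowV0Pn[w /sub_kermxP wK w0]; exists (w *m EI).
have wE k : (w *m EI) 0 (enum_val k) = w 0 k.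
  rewrite mxE (bigD1 k)//= mxE eqxx mulr1 big1 ?addr0// => l lk.
  by rewrite mxE (inj_eq enum_val_inj) (negPf lk) mulr0.
split=> [|i iI|i iJ].
- apply: contraNneq w0 => w0; apply/eqP/rowP => k.
  by rewrite -wE w0 !mxE.
- rewrite mxE big1// => k _; rewrite mxE.
  by case: eqP iI => [<-|_ _]; rewrite ?enum_valP ?mulr0.
- have /matrixP/(_ 0 (enum_rank_in iJ i)) := wK.
  by rewrite /K mulmx_colsub mxE enum_rankK_in// mulmxA => ->; rewrite mxE.
Qed.

(** Weyl's inequality in counting form: a perturbation of size [d] cannot move
    more singular values across a threshold than the shift by [d] allows.  If
    [B] had fewer singular values above [t - d] than [A] has above [t], there
    would be a nonzero [v] in the span of the top eigenvectors of [A] and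
    orthogonal to the top eigenvectors of [B]; on it
    [t |v| <= |v *m A ^t*| <= |v *m B ^t*| + d |v| < (t - d) |v| + d |v|].
    Counting avoids matching the sorted singular values with eigenvectors. *)
Lemma card_gram_eigen_perturb (R : realType) m n (A B : 'M[R[i]]_(m, n))
    (t : R) :
  (#|[set i | (t <= Num.sqrt (gram_eigen A i))%R]%SET|
     <= #|[set i | (t - cfrob (A - B) <= Num.sqrt (gram_eigen B i))%R]%SET|)%N.
Proof.
rewrite leqNgt; apply/negP.
set I := [set i | (t <= _)%R]%SET; set J := [set i | (_ <= _)%R]%SET => JI.
set d := cfrob (A - B) in J JI *.
pose P := spectralmx (A ^t* *m A); pose Q := spectralmx (B ^t* *m B).
have PU : P \is unitarymx := spectral_unitarymx _.
have QU : Q \is unitarymx := spectral_unitarymx _.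
have [u [u0 uI uJ]] := supported_vector_vanishing (P *m Q ^t*) JI.
have [v vE] : exists v, v = u *m P by exists (u *m P).
have [w wE] : exists w, w = u *m (P *m Q ^t*) by exists (u *m (P *m Q ^t*)).
have wv : v = w *m Q by rewrite wE vE mulmxA mulmxKtV.
have uv : cnorm v = cnorm u by rewrite vE; exact: cnorm_unitary.
have wv' : cnorm v = cnorm w by rewrite wv; exact: cnorm_unitary.
rewrite -wE in uJ.
have v_gt0 : 0 < cnorm v.
  rewrite lt_neqAle cnorm_ge0 andbT eq_sym uv; apply: contraNneq u0 => un0.
  have /eqP := l2norm_sqr (fun i => Normc.normc (u 0 i)).
  rewrite -/(cnorm u) un0 expr0n/= eq_sym psumr_eq0 => [/allP u0|i _]; last exact: sqr_ge0.
  apply/eqP/rowP => i; have := u0 i (mem_index_enum _).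
  by rewrite sqrf_eq0 normc_eq0 mxE => /eqP.
have [t0|t0] := leP (t - d) 0.
  (* A nonpositive threshold is met by every singular value of B. *)
  have : (#|I| <= #|J|)%N.
    apply: subset_leq_card; apply/fintype.subsetP => i _.
    by rewrite inE (le_trans t0) ?sqrtr_ge0.
  by rewrite leqNgt JI.
have lowA : t * cnorm v <= cnorm (v *m A ^t*).
  have t_gt0 : 0 <= t by rewrite (le_trans (ltW t0))// gerBl l2norm_ge0.
  rewrite uv vE -(@ler_pXn2r _ 2)// ?nnegrE ?mulr_ge0 ?cnorm_ge0//.
  rewrite gram_eigenE exprMn l2norm_sqr mulr_sumr; apply: ler_sum => i _.
  have [iI|/uI ->] := boolP (i \in I); last first.
    by rewrite Normc.normc0 expr0n !mulr0.
  rewrite ler_wpM2r ?sqr_ge0//; move: iI; rewrite inE => iI.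
  rewrite -(sqr_sqrtr (gram_eigen_ge0 A i)).
  by rewrite ler_pXn2r ?nnegrE ?sqrtr_ge0.
have upB : cnorm (v *m B ^t*) < (t - d) * cnorm v.
  have td0 := ltW t0.
  rewrite wv' wv -(@ltr_pXn2r _ 2) ?nnegrE ?cnorm_ge0 ?mulr_ge0 ?cnorm_ge0 //.
  rewrite gram_eigenE exprMn l2norm_sqr mulr_sumr.
  have le_term i : gram_eigen B i * Normc.normc (w 0 i) ^+ 2 <=
      (t - d) ^+ 2 * Normc.normc (w 0 i) ^+ 2 ?= iff (w 0 i == 0).
    have [->|wi0] := eqVneq (w 0 i) 0.
      by rewrite Normc.normc0 expr0n !mulr0; exact/leif_refl.
    have iJ : i \notin J by apply: contraNN wi0 => /uJ ->.
    apply/leifP; rewrite ltr_pM2r ?exprn_gt0//; last first.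
      by rewrite lt_neqAle normc_ge0 andbT eq_sym normc_eq0.
    rewrite inE -ltNge in iJ; rewrite -(sqr_sqrtr (gram_eigen_ge0 B i)).
    by rewrite ltr_pXn2r ?nnegrE ?sqrtr_ge0 ?(ltW t0).
  have le_sum := leif_sum (fun i (_ : true) => le_term i).
  rewrite (lt_leif le_sum); apply/negP => /forallP w0.
  move: v_gt0; rewrite wv' /cnorm /l2norm big1 ?sqrtr0 ?ltxx// => i _.
  by have /eqP -> := w0 i; rewrite Normc.normc0 expr0n.
have : cnorm (v *m A ^t*) <= cnorm (v *m B ^t*) + d * cnorm v.
  have -> : v *m A ^t* = v *m B ^t* + v *m (A - B) ^t*.
    rewrite -mulmxDr; congr (_ *m _); apply/matrixP => i j.
    by rewrite !mxE rmorphB addrC subrK.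
  by apply: le_trans (cnormD _ _) _; rewrite lerD2l cnorm_mulmx_le.
move=> /(le_trans lowA); apply/negP.
by rewrite -ltNge -ltrBrDr -mulrBl.
Qed.

(** Translates thresholds on a sorted sequence into counts, which are
    invariant under sorting. *)
Lemma le_nth_sorted_count (R : realType) (s : seq R) (t : R) j :
  sorted >=%R s -> (j < size s)%N ->
  (t <= s`_j) = (j < count (fun x => (t <= x)%R) s)%N.
Proof.
move=> s_sorted js; have nth_le := sorted_leq_nth (rev_trans le_trans) lexx 0 s_sorted.
rewrite -[s in RHS](cat_take_drop j) count_cat; apply/idP/idP => [tj|].
  have /eqP -> : count (fun x => (t <= x)%R) (take j s) == size (take j s).
    rewrite -all_count; apply/(all_nthP 0) => i; rewrite size_take js => ij.
    rewrite nth_take// (le_trans tj)//; apply: nth_le; rewrite ?inE ?(ltnW ij)//.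
    exact: ltn_trans ij js.
  by rewrite size_take js (drop_nth 0)//= tj addnS ltnS leq_addr.
rewrite leNgt; apply: contraL => tj; rewrite -leqNgt.
have /eqP -> : count (fun x => (t <= x)%R) (drop j s) == 0%N.
  rewrite -[_ == _]negbK -lt0n -has_count; apply/hasPn => x /(nthP 0) [k].
  rewrite size_drop ltn_subRL => kj <-; rewrite nth_drop -ltNge (le_lt_trans _ tj)//.
  by apply: nth_le; rewrite ?inE ?leq_addr.
by rewrite addn0 (leq_trans (count_size _ _))// size_take js.
Qed.

Lemma le_nth_singular_values (R : realType) m n (A : 'M[R[i]]_(m, n)) t j :
  (j < minn m n)%N ->
  (t <= (singular_values A)`_j) =
  (j < #|[set i | (t <= Num.sqrt (gram_eigen A i))%R]%SET|)%N.
Proof.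
move=> jmn; rewrite /singular_values nth_take//.
rewrite le_nth_sorted_count; last 2 first.
- by apply: sort_sorted => x y; exact: le_total.
- by rewrite size_sort size_map size_enum_ord (leq_trans jmn)// geq_minr.
rewrite count_sort count_map -sum1_count big_enum_cond /= -sum1_card.
by congr (_ < _)%N; apply: eq_bigl => i; rewrite inE.
Qed.

(** Weyl's inequality, with the Frobenius norm in place of the smaller operator
    norm. *)
Lemma singular_values_lipschitz (R : realType) m n (A B : 'M[R[i]]_(m, n)) j :
  (j < minn m n)%N ->
  (singular_values A)`_j - (singular_values B)`_j <= cfrob (A - B).
Proof.
move=> jmn; rewrite lerBlDr -lerBlDl le_nth_singular_values//.
by apply: leq_trans (card_gram_eigen_perturb _ _ _); rewrite -le_nth_singular_values.
Qed.

Lemma singular_values_ge0 (R : realType) m n (A : 'M[R[i]]_(m, n)) j :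
  (j < minn m n)%N -> 0 <= (singular_values A)`_j.
Proof.
move=> jmn; rewrite le_nth_singular_values//.
rewrite (leq_trans jmn)// (leq_trans (geq_minr _ _))//.
rewrite -[X in (X <= _)%N]card_ord -cardsT; apply: subset_leq_card.
by apply/fintype.subsetP => i _; rewrite inE sqrtr_ge0.
Qed.

(** * The grouped logarithmic nuclear norm is Lipschitz *)

Lemma l2norm_le_cst (R : realType) (I : finType) (f : I -> R) (K : R) :
  (forall i, 0 <= f i <= K) -> l2norm f <= Num.sqrt #|I|%:R * K.
Proof.
move=> fK; apply: le_trans (le_l2norm fK) _.
rewrite /l2norm sumr_const -[X in Num.sqrt X]mulr_natl sqrtrM ?ler0n//.
rewrite sqrtr_sqr.
have [i _|I0] := pickP I; last by rewrite (eq_card0 I0) sqrtr0 !mul0r.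
by have /andP[f0 fK'] := fK i; rewrite ger0_norm// (le_trans f0).
Qed.

(** [ln a - ln b = ln (1 + (a - b) / b) <= (a - b) / b], and [b >= eps]. *)
Lemma ln_shift_lipschitz (R : realType) (eps d x y : R) :
  0 < eps -> 0 <= d -> 0 <= x -> 0 <= y -> x - y <= d ->
  ln (x + eps) - ln (y + eps) <= d / eps.
Proof.
move=> eps0 d0 x0 y0 xyd.
have xe : 0 < x + eps by rewrite ltr_wpDl.
have ye : 0 < y + eps by rewrite ltr_wpDl.
rewrite -ln_div ?posrE//.
have -> : (x + eps) / (y + eps) = 1 + (x - y) / (y + eps).
  by field; rewrite gt_eqF.
apply: le_trans (le_ln1Dx _) _.
  by rewrite ltr_pdivlMr//; lra.
rewrite ler_pdivrMr//; apply: le_trans xyd _.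
rewrite mulrAC ler_pdivlMr// ler_wpM2l//; lra.
Qed.

(** By linearity this concerns the transform of [A - B], each value of which is a
    sum of [c] entries multiplied by numbers of modulus one. *)
Lemma normc_dft3_diff_le (R : realType) a b c (A B : tensor R a b c) x :
  Normc.normc (dft3 A x - dft3 B x) <= c%:R * frobT (A - B).
Proof.
rewrite !ffunE -sumrB; apply: le_trans (le_normc_sum _) _.
have -> : c%:R * frobT (A - B) = \sum_(l < c) frobT (A - B).
  by rewrite sumr_const card_ord mulr_natl.
apply: ler_sum => l _; rewrite -mulrBl -rmorphB Normc.normcM.
set th := 2 * pi * _ / _.
have -> : Normc.normc (Complex (cos th) (- sin th)) = 1.
  by rewrite /= sqrrN cos2Dsin2 sqrtr1.
rewrite mulr1 /= expr0n addr0 sqrtr_sqr.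
by have := normr_entry_le_frobT (A - B) (x.1.1, x.1.2, l); rewrite !ffunE.
Qed.

Lemma ltnn_lipschitz (R : realType) (eps : R) a b c : 0 < eps ->
  exists2 K : R, 0 <= K & lipschitzT (@Defs.ltnn R eps a b c) K.
Proof.
move=> eps0; pose D : R := Num.sqrt a%:R * (Num.sqrt b%:R * c%:R).
have D0 : 0 <= D by rewrite !mulr_ge0 ?sqrtr_ge0.
exists (c%:R^-1 * \sum_(k < c) \sum_(j < minn a b) D / eps) => [|A B].
  rewrite mulr_ge0 ?invr_ge0// sumr_ge0// => k _; rewrite sumr_ge0// => j _.
  by rewrite divr_ge0// ltW.
rewrite -mulrBr -mulrA ler_wpM2l ?invr_ge0// -sumrB mulr_suml.
apply: ler_sum => k _; rewrite -sumrB mulr_suml; apply: ler_sum => j _.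
rewrite mulrAC; apply: ln_shift_lipschitz => //.
- by rewrite mulr_ge0 ?frobT_ge0.
- exact: singular_values_ge0.
- exact: singular_values_ge0.
apply: le_trans (singular_values_lipschitz _ _ _) _ => //.
rewrite /D -!mulrA -[a in a%:R]card_ord; apply: l2norm_le_cst => i.
rewrite l2norm_ge0 -[b in b%:R]card_ord; apply: l2norm_le_cst => i'.
rewrite normc_ge0 !mxE; exact: normc_dft3_diff_le.
Qed.

Lemma Phi_lipschitz (R : realType) (eps : R) W H L p N
    (cl : 'I_(W %/ p) * 'I_(H %/ p) -> 'I_N)
    (pix : 'I_(p * p) -> 'I_p * 'I_p) : 0 < eps ->
  exists2 K : R, 0 <= K & lipschitzT (@Phi R eps W H L p N cl pix) K.
Proof.
move=> eps0.
have /choice[K KP] (n : 'I_N) : exists K : R, 0 <= K /\ forall A B : tensor R W H L,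
    Defs.ltnn eps (group_tensor cl pix A n) - Defs.ltnn eps (group_tensor cl pix B n)
      <= K * frobT (A - B).
  have [K K0 KP] := @ltnn_lipschitz R eps #|patches_of cl n| L (p * p) eps0.
  pose T := ('I_#|patches_of cl n| * 'I_L * 'I_(p * p))%type.
  exists (K * Num.sqrt #|{: T}|%:R); split; first by rewrite mulr_ge0 ?sqrtr_ge0.
  move=> A B; apply: le_trans (KP _ _) _; rewrite -mulrA ler_wpM2l//.
  rewrite /frobT.
  have -> : \sum_x (group_tensor cl pix A n - group_tensor cl pix B n) x ^+ 2 =
    \sum_x `|(group_tensor cl pix A n - group_tensor cl pix B n) x| ^+ 2.
    by apply: eq_bigr => x _; rewrite real_normK ?num_real.
  apply: l2norm_le_cst => x; rewrite normr_ge0/= !ffunE/=.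
  set y := (_, _, _).
  by have := normr_entry_le_frobT (A - B) y; rewrite !ffunE.
exists (\sum_n K n) => [|A B]; first by rewrite sumr_ge0// => n _; have [] := KP n.
rewrite -sumrB mulr_suml; apply: ler_sum => n _.
by have [] := KP n.
Qed.

(** * Proximal points and subgradients *)

(** Minimality bounds [f] from below by a concave quadratic touching it at [Z];
    the gradient of that quadratic at [Z] is [- 2 k (Z - P)]. *)
Lemma prox_frechet_subdiff (R : realType) a b c (f : tensor R a b c -> R)
    (k : R) (P Z : tensor R a b c) : 0 <= k ->
  is_argmin (fun Y => k * frobT (Y - P) ^+ 2 + f Y) Z ->
  frechet_subdiff f Z (- (2 * k) *: (Z - P)).
Proof.
move=> k0 Zmin eta eta0; have k1 : 0 < k + 1 by rewrite ltr_wpDl.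
exists (eta / (k + 1)) => [|y]; first exact: divr_gt0.
rewrite ltr_pdivlMr// => ylt; have := Zmin y; rewrite /=.
have -> : y - P = (y - Z) + (Z - P) by rewrite addrA subrK.
rewrite (frobTD_sqr (y - Z)) innerTZl (innerTC (Z - P)).
have n0 := frobT_ge0 (y - Z).
set n := frobT (y - Z) in ylt n0 *; set q := innerT _ _.
have : k * n ^+ 2 <= eta * n.
  rewrite expr2 mulrA ler_wpM2r//; apply: le_trans (ltW ylt).
  by rewrite mulrC ler_wpM2l// lerDl.
lra.
Qed.

(** The Lipschitz bound [f Y >= f x - K |Y - x|] makes the objective coercive,
    so a minimising sequence is bounded and has a convergent subsequence.
    Comparing the minimum with the value at [x] locates the minimiser within
    [K / k] of [x]. *)
Lemma lipschitzT_prox_exists (R : realType) a b c (f : tensor R a b c -> R)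
    (K k : R) (x : tensor R a b c) : 0 <= K -> 0 < k -> lipschitzT f K ->
  exists2 Z, is_argmin (fun Y => k * frobT (Y - x) ^+ 2 + f Y) Z &
    frobT (Z - x) <= K / k.
Proof.
move=> K0 k0 fK; pose g Y := k * frobT (Y - x) ^+ 2 + f Y.
have gx : g x = f x by rewrite /g subrr frobT0 expr0n mulr0 add0r.
have g_ge Y : f x - K * frobT (Y - x) + k * frobT (Y - x) ^+ 2 <= g Y.
  by have := fK x Y; rewrite frobTB_sym /g; lra.
have inf_g : has_inf (range g).
  split; first by exists (g x), x.
  exists (f x - K ^+ 2 / (4 * k)) => _ [Y _ <-]; apply: le_trans (g_ge Y).
  have -> : f x - K * frobT (Y - x) + k * frobT (Y - x) ^+ 2 =
    f x - K ^+ 2 / (4 * k) + k * (frobT (Y - x) - K / (2 * k)) ^+ 2.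
    by field; rewrite gt_eqF.
  by rewrite lerDl mulr_ge0 ?sqr_ge0 ?ltW.
have /choice[Y YP] n : exists Y, g Y < inf (range g) + harmonic n.
  by have [_ [Y _ <-]] := inf_adherent (@harmonic_gt0 R n) inf_g; exists Y.
have infP Z : inf (range g) <= g Z.
  by apply: ge_inf; [case: inf_g | exists Z].
have Yb : forall j : unit, boundedT Y.
  move=> _; exists ((K + 1) / k + 1 + frobT x) => n.
  have -> : Y n = (Y n - x) + x by rewrite subrK.
  apply: le_trans (frobTD _ _) _; rewrite lerD2r.
  have [d1|d1] := leP (frobT (Y n - x)) 1.
    by apply: le_trans d1 _; rewrite lerDr divr_ge0 ?addr_ge0 ?(ltW k0).
  suff : frobT (Y n - x) <= (K + 1) / k by lra.
  rewrite ler_pdivlMr//; set d := frobT _ in d1 *.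
  have h1 : harmonic n <= 1 :> R by rewrite /harmonic/= invf_le1 ?ltr0n// ler1n.
  have h2 : k * d ^+ 2 <= K * d + 1.
    by have := g_ge (Y n); have := YP n; have := infP x; rewrite gx -/d; lra.
  have d0 : 0 < d by lra.
  rewrite -(ler_pM2r d0); nra.
have [phi phi_lt [l /(_ tt) Yl]] := boundedT_cvg_subseq Yb.
have frl : (fun n => frobT (Y (phi n) - x)) @ \oo --> frobT (l tt - x).
  exact: (lipschitzT_cvg (@frobTB_lipschitz _ _ _ _ x) Yl).
have gl : (fun n => g (Y (phi n))) @ \oo --> g (l tt).
  apply: cvgD; last exact: (lipschitzT_cvg fK Yl).
  apply: cvgM; first exact: cvg_cst.
  by under eq_fun do rewrite expr2; rewrite expr2; exact: cvgM.
have hl : (fun n => inf (range g) + harmonic (phi n)) @ \oo --> inf (range g).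
  rewrite -[X in _ --> X]addr0; apply: cvgD; first exact: cvg_cst.
  exact: (cvg_subseq phi_lt cvg_harmonic).
have lmin : g (l tt) <= inf (range g).
  by apply: (ler_cvg_to gl hl); near=> n; exact/ltW/YP.
exists (l tt) => [Z|]; first exact: le_trans lmin (infP Z).
have := le_trans lmin (infP x); rewrite gx => /(le_trans (g_ge _)).
rewrite ler_pdivlMr//; have := frobT_ge0 (l tt - x); set d := frobT _.
rewrite le_eqVlt => /orP[/eqP <-|d0]; first by rewrite mul0r.
by move=> h; rewrite -(ler_pM2r d0); lra.
Unshelve. all: by end_near. Qed.

(** The proximal points of [x] with weights [n + 1] tend to [x], and their
    subgradients [- 2 (n + 1) (Z_n - x)] have norm at most [2 K]; any cluster
    point of these subgradients is a limiting one. *)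
Lemma lipschitzT_limiting_subdiff_neq0 (R : realType) a b c
    (f : tensor R a b c -> R) (K : R) (x : tensor R a b c) :
  0 <= K -> lipschitzT f K -> limiting_subdiff f x !=set0.
Proof.
move=> K0 fK.
have /choice[Z ZP] n : exists Z,
    is_argmin (fun Y => n.+1%:R * frobT (Y - x) ^+ 2 + f Y) Z /\
    frobT (Z - x) <= K / n.+1%:R.
  by have [//|Z] := @lipschitzT_prox_exists _ _ _ _ f K n.+1%:R x K0 _ fK; exists Z.
pose v n := - (2 * n.+1%:R) *: (Z n - x).
have Zx : cvgT Z x.
  apply: (@cvg0_le _ _ (fun n => K * harmonic n)) => [n|].
    by have [_ ?] := ZP n; rewrite frobT_ge0.
  by rewrite -(mulr0 K); apply: cvgM; [exact: cvg_cst | exact: cvg_harmonic].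
have vb : forall j : unit, boundedT v.
  move=> _; exists (2 * K) => n; rewrite frobTZ normrN ger0_norm ?mulr_ge0//.
  have [_] := ZP n; rewrite ler_pdivlMr ?ltr0n// => h.
  by rewrite -mulrA ler_wpM2l// mulrC.
have [phi phi_lt [l /(_ tt) vl]] := boundedT_cvg_subseq vb.
exists (l tt), (fun n => Z (phi n)), (fun n => v (phi n)); split => //.
- exact: (cvgT_subseq phi_lt Zx).
- exact: (lipschitzT_cvg fK (cvgT_subseq phi_lt Zx)).
- by move=> n; apply: prox_frechet_subdiff => //; have [] := ZP (phi n).
Qed.

(** * Finite differences and the mode-3 unfolding *)

(** The mode products entry by entry, free of the fibre ordering chosen in the
    unfoldings. *)
Lemma mode1E (R : realType) a b c d (A : tensor R a b c) (D : 'M[R]_(d, a)) x :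
  mode1 A D x = \sum_i D x.1.1 i * A (i, x.1.2, x.2).
Proof.
by rewrite ffunE !mxE; apply: eq_bigr => i _; rewrite [unfold1 _ _ _]mxE mxvecE mxE.
Qed.

Lemma mode2E (R : realType) a b c d (A : tensor R a b c) (D : 'M[R]_(d, b)) x :
  mode2 A D x = \sum_j D x.1.2 j * A (x.1.1, j, x.2).
Proof.
by rewrite ffunE !mxE; apply: eq_bigr => i _; rewrite [unfold2 _ _ _]mxE mxvecE mxE.
Qed.

Lemma mode3E (R : realType) a b c d (A : tensor R a b c) (D : 'M[R]_(d, c)) x :
  mode3 A D x = \sum_k D x.2 k * A (x.1.1, x.1.2, k).
Proof.
by rewrite ffunE !mxE; apply: eq_bigr => i _; rewrite [unfold3 _ _ _]mxE mxvecE mxE.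
Qed.

Lemma nabla_linear (R : realType) a b c t : linear (@nabla R a b c t).
Proof.
move=> k A B; apply/ffunP => x;
have scE (T : tensor R a b c) : (k *: T) x = k * T x by rewrite ffunE.
rewrite [RHS]ffunE scE /nabla.
have sumE (I : finType) (u v w : I -> R) :
    \sum_i u i * (k * v i + w i) = k * \sum_i u i * v i + \sum_i u i * w i.
  by rewrite mulr_sumr -big_split/=; apply: eq_bigr => i _; ring.
case: (val t) => [|[|n]]; rewrite ?mode1E ?mode2E ?mode3E -sumE.
all: by apply: eq_bigr => i _; rewrite !ffunE.
Qed.

HB.instance Definition _ (R : realType) a b c (t : 'I_3) :=
  GRing.isLinear.Build R (tensor R a b c) (tensor R a b c) _ (@nabla R a b c t)
    (@nabla_linear R a b c t).

Lemma unfold3E (R : realType) a b c (A : tensor R a b c) k i j :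
  unfold3 A k (mxvec_index i j) = A (i, j, k).
Proof. by rewrite mxE mxvecE mxE. Qed.

Lemma unfold3_linear (R : realType) a b c : linear (@unfold3 R a b c).
Proof.
move=> k A B; apply/matrixP => i q; case/mxvec_indexP: q => j l.
by rewrite !(mxE, unfold3E, mxvecE) !ffunE.
Qed.

HB.instance Definition _ (R : realType) a b c :=
  GRing.isLinear.Build R (tensor R a b c) 'M[R]_(c, a * b) _ (@unfold3 R a b c)
    (@unfold3_linear R a b c).

Lemma fold3K (R : realType) a b c (K : 'M[R]_(c, a * b)) :
  unfold3 (fold3 K : tensor R a b c) = K.
Proof.
apply/matrixP => i q; case/mxvec_indexP: q => j l.
by rewrite unfold3E ffunE !mxE.
Qed.

(** Unfolding is an isometry; the trace form makes transposed matrices appear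
    as adjoints. *)
Lemma innerT_unfold3 (R : realType) a b c (A B : tensor R a b c) :
  innerT A B = \tr ((unfold3 A)^T *m unfold3 B).
Proof.
rewrite /mxtrace (reindex _ (curry_mxvec_bij a b))/= /innerT.
under [RHS]eq_bigr do rewrite mxE.
rewrite pair_bigA; apply: eq_bigr => -[[i j] k] _ /=.
by rewrite mxE !unfold3E.
Qed.

Lemma frobM_sqr (R : realType) m n (P : 'M[R]_(m, n)) :
  frobM P ^+ 2 = \tr (P^T *m P).
Proof.
rewrite sqr_sqrtr; last first.
  by apply: sumr_ge0 => i _; apply: sumr_ge0 => j _; exact: sqr_ge0.
rewrite exchange_big; apply: eq_bigr => j _; rewrite mxE.
by apply: eq_bigr => i _; rewrite mxE expr2.
Qed.

Lemma mxtrace_trmul_self_eq0 (R : realType) m n (P : 'M[R]_(m, n)) :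
  \tr (P^T *m P) = 0 -> P = 0.
Proof.
rewrite -frobM_sqr sqr_sqrtr; last first.
  by apply: sumr_ge0 => i _; apply: sumr_ge0 => j _; exact: sqr_ge0.
move=> /eqP; rewrite psumr_eq0 => [/allP h|i _]; last first.
  by apply: sumr_ge0 => j _; exact: sqr_ge0.
apply/matrixP => i j; have := h i (mem_index_enum _).
rewrite psumr_eq0 => [/allP/(_ j (mem_index_enum _))|l _]; last exact: sqr_ge0.
by rewrite sqrf_eq0 mxE => /eqP.
Qed.

Lemma frobM_line (R : realType) m n (P Q : 'M[R]_(m, n)) (s : R) :
  frobM (P + s *: Q) ^+ 2 =
  frobM P ^+ 2 + 2 * s * \tr (P^T *m Q) + s ^+ 2 * frobM Q ^+ 2.
Proof.
have QP : \tr (Q^T *m P) = \tr (P^T *m Q) by rewrite -mxtrace_tr trmx_mul trmxK.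
rewrite !frobM_sqr [(P + _)^T]linearD/= linearZ/= mulmxDl !mulmxDr.
rewrite -!scalemxAl -!scalemxAr.
by rewrite !(linearD, linearZ)/= QP; ring.
Qed.

Lemma mxtrace_trmulDl (R : realType) m n (A B D : 'M[R]_(m, n)) :
  \tr ((A + B)^T *m D) = \tr (A^T *m D) + \tr (B^T *m D).
Proof. by rewrite [(A + B)^T]linearD/= mulmxDl mxtraceD. Qed.

Lemma mxtrace_trmulZl (R : realType) m n (k : R) (A D : 'M[R]_(m, n)) :
  \tr ((k *: A)^T *m D) = k * \tr (A^T *m D).
Proof. by rewrite [(k *: A)^T]linearZ/= -scalemxAl mxtraceZ. Qed.

Lemma mxtrace_trmulNl (R : realType) m n (A D : 'M[R]_(m, n)) :
  \tr ((- A)^T *m D) = - \tr (A^T *m D).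
Proof. by rewrite -scaleN1r mxtrace_trmulZl mulN1r. Qed.

Lemma mxtrace_trmulNr (R : realType) m n (A D : 'M[R]_(m, n)) :
  \tr (A^T *m - D) = - \tr (A^T *m D).
Proof. by rewrite mulmxN raddfN. Qed.

Lemma mxtrace_trmul_suml (R : realType) m n (I : finType)
    (A : I -> 'M[R]_(m, n)) (D : 'M[R]_(m, n)) :
  \tr ((\sum_i A i)^T *m D) = \sum_i \tr ((A i)^T *m D).
Proof.
elim/big_rec2: _ => [|i y S _ <-]; first by rewrite trmx0 mul0mx mxtrace0.
by rewrite mxtrace_trmulDl.
Qed.

Lemma tensor_sum_delta (R : realType) a b c (A : tensor R a b c) :
  A = \sum_y A y *: [ffun z => (z == y)%:R].
Proof.
apply/ffunP => x; rewrite sum_ffunE (bigD1 x)//= !ffunE eqxx.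
rewrite big1 => [|y yx]; first by rewrite addr0; exact/esym/mulr1.
by rewrite !ffunE eq_sym (negPf yx); exact: mulr0.
Qed.

Lemma cvgT_nabla (R : realType) a b c t (A : nat -> tensor R a b c) l :
  cvgT A l -> cvgT (fun k => nabla t (A k)) (nabla t l).
Proof.
pose I := ('I_a * 'I_b * 'I_c)%type.
have [g gE] : exists g : I -> I -> R, forall (B : tensor R a b c) x,
    nabla t B x = \sum_y B y * g x y.
  exists (fun x y => nabla t [ffun z => (z == y)%:R] x) => B x.
  rewrite {1}(tensor_sum_delta B) linear_sum/= sum_ffunE.
  by apply: eq_bigr => y _; rewrite linearZ/= ffunE.
move=> /cvgTP Al; apply/cvgTP => x; rewrite gE; under eq_fun do rewrite gE.
apply: (@cvg_sum_seq R _ _ (fun y k => A k y * g x y) (fun y => l y * g x y)) => y.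
by apply: cvgM => //; exact: cvg_cst.
Qed.

Definition cvg_entries (R : realType) m n (P : nat -> 'M[R]_(m, n))
    (l : 'M[R]_(m, n)) :=
  forall i j, (fun k => P k i j) @ \oo --> (l i j : R).

Lemma cvg_entries_unfold3 (R : realType) a b c (A : nat -> tensor R a b c) l :
  cvgT A l -> cvg_entries (fun k => unfold3 (A k)) (unfold3 l).
Proof.
move=> /cvgTP Al i q; case/mxvec_indexP: q => j k; rewrite unfold3E.
by under eq_fun do rewrite unfold3E; exact: Al.
Qed.

Lemma cvg_entries_cst (R : realType) m n (l : 'M[R]_(m, n)) :
  cvg_entries (fun=> l) l.
Proof. by move=> i j; exact: cvg_cst. Qed.

Lemma cvg_entries_mulmx (R : realType) m n p (P : nat -> 'M[R]_(m, n))
    (Q : nat -> 'M[R]_(n, p)) l l' :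
  cvg_entries P l -> cvg_entries Q l' ->
  cvg_entries (fun k => P k *m Q k) (l *m l').
Proof.
move=> Pl Ql' i j; rewrite mxE; under eq_fun do rewrite mxE.
apply: (@cvg_sum_seq R _ _ (fun y k => P k i y * Q k y j) (fun y => l i y * l' y j)) => y.
exact: cvgM.
Qed.

Lemma cvg_entriesB (R : realType) m n (P Q : nat -> 'M[R]_(m, n)) l l' :
  cvg_entries P l -> cvg_entries Q l' -> cvg_entries (fun k => P k - Q k) (l - l').
Proof.
move=> Pl Ql' i j; rewrite !mxE; under eq_fun do rewrite !mxE.
exact: cvgB.
Qed.

Lemma cvg_entriesD (R : realType) m n (P Q : nat -> 'M[R]_(m, n)) l l' :
  cvg_entries P l -> cvg_entries Q l' -> cvg_entries (fun k => P k + Q k) (l + l').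
Proof.
move=> Pl Ql' i j; rewrite !mxE; under eq_fun do rewrite !mxE.
exact: cvgD.
Qed.

Lemma cvg_entriesZ (R : realType) m n (a : R) (P : nat -> 'M[R]_(m, n)) l :
  cvg_entries P l -> cvg_entries (fun k => a *: P k) (a *: l).
Proof.
move=> Pl i j; rewrite !mxE; under eq_fun do rewrite !mxE.
by apply: cvgM => //; exact: cvg_cst.
Qed.

Lemma cvg_entries_sum (R : realType) m n (I : finType)
    (P : I -> nat -> 'M[R]_(m, n)) (l : I -> 'M[R]_(m, n)) :
  (forall t, cvg_entries (P t) (l t)) ->
  cvg_entries (fun k => \sum_t P t k) (\sum_t l t).
Proof.
move=> Pl i j; rewrite summxE; under eq_fun do rewrite summxE.
by apply: (@cvg_sum_seq R _ _ (fun t k => P t k i j) (fun t => l t i j)) => t; exact: Pl.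
Qed.

Lemma cvg_entries_unique (R : realType) m n (P : nat -> 'M[R]_(m, n)) l l' :
  cvg_entries P l -> cvg_entries P l' -> l = l'.
Proof.
move=> Pl Pl'; apply/matrixP => i j.
exact: cvg_unique (Pl i j) (Pl' i j).
Qed.

(** * First-order conditions of the three subproblems *)

(** A quadratic polynomial that is minimal at [0] has no linear term; this is
    the derivative test for the quadratic subproblems. *)
Lemma first_order_eq0 (R : realType) (p q : R) :
  (forall s, 0 <= s * p + s ^+ 2 * q) -> p = 0.
Proof.
move=> h; pose r := `|q| + 1.
have r0 : 0 < r by rewrite ltr_wpDl.
have := h (- p / r).
have -> : - p / r * p + (- p / r) ^+ 2 * q = - ((p / r) ^+ 2 * (r - q)).
  by field; rewrite gt_eqF.
have rq : 0 < r - q by have := ler_norm q; rewrite /r; lra.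
rewrite oppr_ge0 pmulr_lle0// => pr0.
have : (p / r) ^+ 2 == 0 by rewrite eq_le pr0 sqr_ge0.
by rewrite sqrf_eq0 mulf_eq0 invr_eq0 (gt_eqF r0) orbF => /eqP.
Qed.

(** The derivative of the objective in the direction of the [x]-th canonical
    tensor is [2 * mu] times the difference of the two sides at [x]. *)
Lemma argmin_nabla_fit (R : realType) a b c (t : 'I_3) (mu : R)
    (C m H v Z : tensor R a b c) : 0 < mu ->
  is_argmin (fun Y => mu * frobT (Y - C + m) ^+ 2
    + mu * frobT (H - nabla t Y + v) ^+ 2) Z ->
  Z - C + m = adjointT (nabla t) (H - nabla t Z + v).
Proof.
move=> mu0 Zmin; apply/ffunP => x; rewrite [RHS]ffunE.
set e : tensor R a b c := [ffun y => _]; set B := H - nabla t Z + v.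
set A := Z - C + m.
suff : 2 * mu * (innerT A e - innerT B (nabla t e)) = 0.
  move/eqP; rewrite mulf_eq0 mulf_eq0 pnatr_eq0/= (gt_eqF mu0)/= subr_eq0.
  by move=> /eqP; rewrite innerTC innerT_deltal innerTC.
apply: (@first_order_eq0 _ _ (mu * (frobT e ^+ 2 + frobT (- nabla t e) ^+ 2))) => s.
have := Zmin (Z + s *: e); rewrite /=.
have -> : Z + s *: e - C + m = A + s *: e.
  by rewrite /A -!addrA; congr (_ + _); rewrite addrC -addrA.
have -> : H - nabla t (Z + s *: e) + v = B + s *: (- nabla t e).
  rewrite /B linearD linearZ/= opprD scalerN -!addrA.
  by congr (_ + (_ + _)); rewrite addrC.
rewrite !frobT_line innerTNr -/A -/B; lra.
Qed.

(** The right-hand side, [K], is half the gradient of the objective in unfolded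
    form.  The derivative in the direction [D] is [2 \tr (K^T *m unfold3 D)];
    the direction with [unfold3 D = K] gives [K = 0]. *)
Lemma argmin_data_fit (R : realType) (W H nS w h s L : nat)
    (X : tensor R w h nS) (Y : tensor R W H s)
    (B : 'M[R]_(W * H)) (Sm : 'M[R]_(W * H, w * h)) (F : 'M[R]_(s, nS))
    (Rm : 'M[R]_(nS, L)) (mu : R) (G m : 'I_3 -> tensor R W H L) Z :
  is_argmin (fun C => data_fit X Y B Sm F Rm C
    + mu * \sum_(t < 3) frobT (G t - C + m t) ^+ 2) Z ->
  0 = Rm^T *m (Rm *m unfold3 Z *m B *m Sm - unfold3 X) *m Sm^T *m B^T
      + Rm^T *m F^T *m (F *m Rm *m unfold3 Z - unfold3 Y)
      - mu *: \sum_(t < 3) unfold3 (G t - Z + m t).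
Proof.
move=> Zmin; set K := (X in 0 = X); apply/esym/mxtrace_trmul_self_eq0.
pose D : tensor R W H L := fold3 K; have DK : unfold3 D = K := fold3K K.
rewrite -{2}DK.
have [P PE] : exists P, unfold3 X - Rm *m unfold3 Z *m B *m Sm = P by eexists.
have [Q QE] : exists Q, unfold3 Y - F *m Rm *m unfold3 Z = Q by eexists.
pose P' := - (Rm *m unfold3 D *m B *m Sm).
pose Q' := - (F *m Rm *m unfold3 D).
have KE : \tr (K^T *m unfold3 D) = \tr (P^T *m P') + \tr (Q^T *m Q')
    + mu * \sum_(t < 3) innerT (G t - Z + m t) (- D).
  have -> : K = - (Rm^T *m P *m Sm^T *m B^T) - Rm^T *m F^T *m Q
      - mu *: \sum_(t < 3) unfold3 (G t - Z + m t).
    by rewrite /K -(opprB (unfold3 X)) -(opprB (unfold3 Y)) PE QE !(mulmxN, mulNmx).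
  rewrite !(mxtrace_trmulDl, mxtrace_trmulNl, mxtrace_trmulZl).
  rewrite /P' /Q' !mxtrace_trmulNr; congr (_ + _ + _).
  - congr (- _).
    by rewrite !trmx_mul !trmxK !mulmxA [RHS]mxtrace_mulC !mulmxA [RHS]mxtrace_mulC !mulmxA.
  - by rewrite !trmx_mul !trmxK !mulmxA.
  - rewrite -mulrN mxtrace_trmul_suml -sumrN; congr (_ * _).
    by apply: eq_bigr => t _; rewrite innerTNr innerT_unfold3.
suff : 2 * \tr (K^T *m unfold3 D) = 0 by move/eqP; rewrite mulf_eq0 pnatr_eq0 => /eqP.
apply: (@first_order_eq0 _ _ (frobM P' ^+ 2 + frobM Q' ^+ 2
   + mu * \sum_(t < 3) frobT (- D) ^+ 2)) => r.
have := Zmin (Z + r *: D); rewrite /= /data_fit.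
have -> : unfold3 X - Rm *m unfold3 (Z + r *: D) *m B *m Sm = P + r *: P'.
  rewrite linearD linearZ/= mulmxDr !mulmxDl -scalemxAr -!scalemxAl.
  by rewrite scalerN opprD addrA PE.
have -> : unfold3 Y - F *m Rm *m unfold3 (Z + r *: D) = Q + r *: Q'.
  by rewrite linearD linearZ/= mulmxDr -scalemxAr scalerN opprD addrA QE.
have -> : \sum_(t < 3) frobT (G t - (Z + r *: D) + m t) ^+ 2 =
    \sum_(t < 3) frobT (G t - Z + m t) ^+ 2
    + 2 * r * \sum_(t < 3) innerT (G t - Z + m t) (- D)
    + r ^+ 2 * \sum_(t < 3) frobT (- D) ^+ 2.
  rewrite !mulr_sumr -!big_split/=; apply: eq_bigr => t _.
  rewrite -frobT_line scalerN opprD -!addrA.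
  by congr (frobT (_ + (_ + _)) ^+ 2); rewrite addrC.
rewrite KE !frobM_line PE QE; lra.
Qed.

(** Closedness of the proximal optimality condition.  For [alpha > 0] the step
    gives Frechet subgradients of [f] at [H k] that converge to
    [- alpha^-1 *: Vs].  For [alpha = 0] the minimiser is [P k] itself, so [Vs = 0]
    and any limiting subgradient will do. *)
Lemma argmin_prox_limiting_subdiff (R : realType) a b c
    (f : tensor R a b c -> R) (K mu alpha : R)
    (P H : nat -> tensor R a b c) (Hs Vs : tensor R a b c) :
  0 <= K -> lipschitzT f K -> 0 < mu -> 0 <= alpha ->
  (forall k, is_argmin (fun Z => mu * frobT (Z - P k) ^+ 2 + alpha * f Z) (H k)) ->
  cvgT H Hs -> cvgT (fun k => (2 * mu) *: (H k - P k)) Vs ->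
  exists2 xi, limiting_subdiff f Hs xi & alpha *: xi + Vs = 0.
Proof.
move=> K0 fK mu0 alpha0 Hmin HHs HV.
have [alpha_gt0|alpha_le0] := ltP 0 alpha.
  exists (- alpha^-1 *: Vs); last first.
    by rewrite scalerA mulrN divff ?gt_eqF// scaleN1r addNr.
  exists H, (fun k => - alpha^-1 *: ((2 * mu) *: (H k - P k))); split => //.
  - exact: lipschitzT_cvg fK HHs.
  - move=> k; rewrite scalerA.
    have -> : - alpha^-1 * (2 * mu) = - (2 * (mu / alpha)) by ring.
    apply: prox_frechet_subdiff => [|Z /=]; first by rewrite divr_ge0 ?ltW.
    have := Hmin k Z; rewrite /= -(ler_pM2l (_ : 0 < alpha^-1)) ?invr_gt0//.
    by rewrite !mulrDr !mulrA mulVf ?gt_eqF// !mul1r !(mulrC alpha^-1).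
  - exact: cvgTZ.
have {alpha0 alpha_le0} alpha0 : alpha = 0 by apply/eqP; rewrite eq_le alpha_le0.
have [xi fxi] := lipschitzT_limiting_subdiff_neq0 Hs K0 fK.
exists xi; rewrite // alpha0 scale0r add0r.
apply: cvgT_unique HV _.
have -> : (fun k => (2 * mu) *: (H k - P k)) = fun=> 0; last exact: cvgT_cst.
apply/funext => k.
have := Hmin k (P k); rewrite /= alpha0 !mul0r !addr0 subrr frobT0 expr0n mulr0.
rewrite pmulr_rle0// => HP.
have /eqP HP0 : frobT (H k - P k) ^+ 2 == 0 by rewrite eq_le HP sqr_ge0.
suff -> : H k - P k = 0 by rewrite scaler0.
apply/ffunP => x; rewrite [RHS]ffunE; apply/normr0_eq0/eqP.
rewrite eq_le normr_ge0 andbT; apply: le_trans (normr_entry_le_frobT _ x) _.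
by move/eqP: HP0; rewrite sqrf_eq0 => /eqP ->.
Qed.

(** * Almost monotone descent *)

(** If [r] stayed above [eta] from some index on, [E] would eventually lose at
    least [eta / 2] at each step and leave every lower bound. *)
Lemma almost_descent_liminf0 (R : realType) (r E e : nat -> R) (lb : R) :
  (forall k, r k <= E k - E k.+1 + e k) -> (forall k, lb <= E k) ->
  e @ \oo --> (0 : R) ->
  forall eta, 0 < eta -> forall K, exists2 k, (K <= k)%N & r k < eta.
Proof.
move=> rE Elb e0 eta eta0 K; apply: contrapT => h.
have r_ge k : (K <= k)%N -> eta <= r k.
  by move=> Kk; rewrite leNgt; apply/negP => rk; apply: h; exists k.
have [K' _ eK'] : \forall k \near \oo, `|e k| < eta / 2.
  by apply: cvgr0_norm_lt => //; rewrite divr_gt0.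
(* Past K0 the assumed lower bound on r and the bound eta / 2 on e both hold. *)
pose K0 := maxn K K'.
have dec n : E (K0 + n)%N <= E K0 - n%:R * (eta / 2).
  elim: n => [|n ih]; first by rewrite addn0 mul0r subr0.
  have h1 := r_ge (K0 + n)%N (leq_trans (leq_maxl _ _) (leq_addr _ _)).
  have h2 := rE (K0 + n)%N.
  have /ltr_normlW h3 := eK' (K0 + n)%N (leq_trans (leq_maxr _ _) (leq_addr _ _)).
  rewrite addnS -natr1; lra.
have e2 : 0 < eta / 2 by rewrite divr_gt0.
have := archi_boundP (_ : 0 <= (E K0 - lb) / (eta / 2)).
rewrite divr_ge0 ?subr_ge0 ?(ltW e2)// => /(_ isT).
set n := Num.bound _; rewrite ltr_pdivrMr// => h1.
by have := dec n; have := Elb (K0 + n)%N; lra.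
Qed.

Lemma liminf0_subseq (R : realType) (r : nat -> R) :
  (forall k, 0 <= r k) ->
  (forall eta, 0 < eta -> forall K, exists2 k, (K <= k)%N & r k < eta) ->
  exists2 phi : nat -> nat, {homo phi : i j / (i < j)%N} &
    (fun k => r (phi k)) @ \oo --> (0 : R).
Proof.
move=> r0 h.
have /choice[f fP] (jK : nat * nat) : exists k, (jK.2 <= k)%N /\ r k < harmonic jK.1.
  by have [k Kk rk] := h _ (@harmonic_gt0 R jK.1) jK.2; exists k.
pose phi := fix phi j := if j is j'.+1 then f (j, (phi j').+1) else f (0, 0)%N.
exists phi.
  apply: homo_ltn => [|j]; first exact: ltn_trans.
  by have [] := fP (j.+1, (phi j).+1).
apply: (@cvg0_le _ _ harmonic) => [k|]; last exact: cvg_harmonic.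
by rewrite r0/= ltW//; case: k => [|k]; [have [] := fP (0, 0)%N | have [] := fP (k.+1, (phi k).+1)].
Qed.

Lemma data_fit_ge0 (R : realType) (W H nS w h s L : nat)
    (X : tensor R w h nS) (Y : tensor R W H s)
    (B : 'M[R]_(W * H)) (Sm : 'M[R]_(W * H, w * h)) (F : 'M[R]_(s, nS))
    (Rm : 'M[R]_(nS, L)) (C : tensor R W H L) :
  0 <= data_fit X Y B Sm F Rm C.
Proof. by rewrite addr_ge0 ?sqr_ge0. Qed.

(** The minimiser [C'] is compared with the competitor [C].  Expanding
    the squares leaves the cross terms [<C, M>] and [<C', M>]; trading [M] for [M']
    in the second makes them telescope along the iteration, at the price of the
    error term [<C', M' - M>]. *)
Lemma argmin_penalty_descent (R : realType) a b c (f : tensor R a b c -> R)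
    (mu : R) (G M M' : 'I_3 -> tensor R a b c) (C C' : tensor R a b c) :
  0 < mu ->
  is_argmin (fun Z => f Z
    + mu * \sum_(t < 3) frobT (G t - Z + (2 * mu)^-1 *: M t) ^+ 2) C' ->
  mu * \sum_(t < 3) frobT (G t - C') ^+ 2 <=
  (f C - \sum_(t < 3) innerT C (M t)) - (f C' - \sum_(t < 3) innerT C' (M' t))
  + \sum_(t < 3) (mu * frobT (G t - C) ^+ 2 - innerT C' (M' t - M t)).
Proof.
move=> mu0 Cmin; have := Cmin C; rewrite /=.
have E Z : mu * \sum_(t < 3) frobT (G t - Z + (2 * mu)^-1 *: M t) ^+ 2 =
    mu * (\sum_(t < 3) frobT (G t - Z) ^+ 2) - \sum_(t < 3) innerT Z (M t)
    + \sum_(t < 3) (innerT (G t) (M t) + mu * ((2 * mu)^-1 * frobT (M t)) ^+ 2).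
  rewrite !mulr_sumr -sumrN -!big_split/=; apply: eq_bigr => t _.
  rewrite frobT_line innerTDl innerTNl; field; rewrite gt_eqF//.
rewrite !E => h.
rewrite [X in _ <= _ + X]big_split/= -mulr_sumr sumrN.
have -> : \sum_(t < 3) innerT C' (M' t - M t) =
    \sum_(t < 3) innerT C' (M' t) - \sum_(t < 3) innerT C' (M t).
  by rewrite -sumrB; apply: eq_bigr => t _; rewrite innerTDr innerTNr.
lra.
Qed.

(** * Convergence to a KKT point *)

Theorem theorem3p1 (R : realType) (W H nS w h s L : nat)
  (hW : (0 < W)%N) (hH : (0 < H)%N) (hS : (0 < nS)%N)
  (hw : (0 < w)%N) (hh : (0 < h)%N) (hs : (0 < s)%N)
  (hL : (0 < L)%N) (hLS : (L < nS)%N)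
  (X : tensor R w h nS) (Y : tensor R W H s)
  (B : 'M[R]_(W * H)) (Sm : 'M[R]_(W * H, w * h)) (F : 'M[R]_(s, nS))
  (U : 'M[R]_nS) (Sig : 'M[R]_(nS, w * h)) (Q : 'M[R]_(w * h))
  (hsvd : is_svd (unfold3 X) U Sig Q)
  (Rm : 'M[R]_(nS, L)) (hRm : Rm = first_cols (ltnW hLS) U)
  (alpha : 'I_3 -> R) (halpha : forall t, 0 <= alpha t)
  (mu : R) (hmu : 0 < mu) (eps : R) (heps : 0 < eps)
  (p : nat) (hp : (0 < p)%N) (hpW : (p %| W)%N) (hpH : (p %| H)%N)
  (N : nat) (cl : 'I_(W %/ p) * 'I_(H %/ p) -> 'I_N)
  (pix : 'I_(p * p) -> 'I_p * 'I_p) (hpix : bijective pix)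
  (C : nat -> tensor R W H L)
  (G Hh M V : 'I_3 -> nat -> tensor R W H L)
  (stepC : forall k, is_argmin
     (fun Z : tensor R W H L => data_fit X Y B Sm F Rm Z
        + mu * \sum_(t < 3) frobT (G t k - Z + (2 * mu)^-1 *: M t k) ^+ 2)
     (C k.+1))
  (stepH : forall k t, is_argmin
     (fun Z : tensor R W H L =>
        mu * frobT (Z - nabla t (G t k) + (2 * mu)^-1 *: V t k) ^+ 2
        + alpha t * Phi eps cl pix Z)
     (Hh t k.+1))
  (stepG : forall k t, is_argmin
     (fun Z : tensor R W H L =>
        mu * frobT (Z - C k.+1 + (2 * mu)^-1 *: M t k) ^+ 2
        + mu * frobT (Hh t k.+1 - nabla t Z + (2 * mu)^-1 *: V t k) ^+ 2)
     (G t k.+1))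
  (stepV : forall k t,
     V t k.+1 = V t k + (2 * mu) *: (Hh t k.+1 - nabla t (G t k.+1)))
  (stepM : forall k t,
     M t k.+1 = M t k + (2 * mu) *: (G t k.+1 - C k.+1))
  (hdM : forall t, cvgT (fun k => M t k.+1 - M t k) 0)
  (hdV : forall t, cvgT (fun k => V t k.+1 - V t k) 0)
  (hbC : boundedT C)
  (hbG : forall t, boundedT (G t)) (hbH : forall t, boundedT (Hh t))
  (hbM : forall t, boundedT (M t)) (hbV : forall t, boundedT (V t)) :
  exists (phi : nat -> nat) (Cs : tensor R W H L)
         (Gs Hs : 'I_3 -> tensor R W H L),
    [/\ {homo phi : i j / (i < j)%N},
        cvgT (fun k => C (phi k)) Cs,
        forall t, cvgT (fun k => G t (phi k)) (Gs t),
        forall t, cvgT (fun k => Hh t (phi k)) (Hs t)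
      & exists Ms Vs : 'I_3 -> tensor R W H L,
          [/\ forall t, 0 = Gs t - Cs,
              forall t, 0 = Hs t - nabla t (Gs t),
              0 = Rm^T *m (Rm *m unfold3 Cs *m B *m Sm - unfold3 X)
                    *m Sm^T *m B^T
                  + Rm^T *m F^T *m (F *m Rm *m unfold3 Cs - unfold3 Y)
                  - 2^-1 *: \sum_(i < 3) unfold3 (Ms i),
              forall t, 0 = Ms t - adjointT (nabla t) (Vs t)
            & forall t,
                [set alpha t *: xi + Vs t
                  | xi in limiting_subdiff (Phi eps cl pix) (Hs t)] 0]].
Proof.

pose r k := mu * \sum_(t < 3) frobT (G t k - C k.+1) ^+ 2.
have r0 k : 0 <= r k.
  by rewrite mulr_ge0 ?(ltW hmu)// sumr_ge0// => t _; exact: sqr_ge0.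
have dM k t : G t k.+1 - C k.+1 = (2 * mu)^-1 *: (M t k.+1 - M t k).
  rewrite stepM addrAC subrr add0r scalerA mulVf ?scale1r// gt_eqF// mulr_gt0//.
have dV k t : Hh t k.+1 - nabla t (G t k.+1) = (2 * mu)^-1 *: (V t k.+1 - V t k).
  rewrite stepV addrAC subrr add0r scalerA mulVf ?scale1r// gt_eqF// mulr_gt0//.
have GC0 t : cvgT (fun k => G t k.+1 - C k.+1) 0.
  have := cvgTZ (2 * mu)^-1 (hdM t); rewrite scaler0.
  by under eq_fun do rewrite -dM.
have HG0 t : cvgT (fun k => Hh t k.+1 - nabla t (G t k.+1)) 0.
  have := cvgTZ (2 * mu)^-1 (hdV t); rewrite scaler0.
  by under eq_fun do rewrite -dV.
have [phi1 phi1_lt r_phi1] : exists2 phi : nat -> nat,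
    {homo phi : i j / (i < j)%N} & (fun k => r (phi k)) @ \oo --> (0 : R).
  apply: liminf0_subseq => //.
  have [KC CK] := hbC; have /choice[KM MK] := hbM.
  have KC0 : 0 <= KC := le_trans (frobT_ge0 _) (CK 0%N).
  apply: (@almost_descent_liminf0 _ _
    (fun k => data_fit X Y B Sm F Rm (C k) - \sum_(t < 3) innerT (C k) (M t k))
    (fun k => \sum_(t < 3) (mu * frobT (G t k - C k) ^+ 2
       - innerT (C k.+1) (M t k.+1 - M t k)))
    (- \sum_(t < 3) KC * KM t)) => [k|k|].
  - exact: (argmin_penalty_descent (fun t => M t k.+1) (C k) hmu (stepC k)).
  - have : \sum_(t < 3) innerT (C k) (M t k) <= \sum_(t < 3) KC * KM t.
      apply: ler_sum => t _; apply: le_trans (le_trans (ler_norm _) (normr_innerT_le _ _)) _.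
      by rewrite ler_pM ?frobT_ge0.
    by have := data_fit_ge0 X Y B Sm F Rm (C k); lra.
  - have z3 : \sum_(t < 3) (0 : R) = 0 by rewrite big1.
    rewrite -[X in _ --> X]z3.
    apply: (@cvg_sum_seq R _ _ (fun (t : 'I_3) k => mu * frobT (G t k - C k) ^+ 2
       - innerT (C k.+1) (M t k.+1 - M t k)) (fun=> 0)) => t.
    rewrite -[X in _ --> X](subrr 0); apply: cvgB.
      have GC2 : (fun k => mu * frobT (G t k.+1 - C k.+1) ^+ 2) @ \oo --> (0 : R).
        have := GC0 t; rewrite /cvgT; under eq_fun do rewrite subr0.
        by move=> GC0t; exact/cvg0Ml/cvg0_sqr.
      by rewrite -cvg_shiftS.
    apply/norm_cvg0P.
    apply: (@cvg0_le _ _ (fun k => KC * frobT (M t k.+1 - M t k))) => [k|].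
      rewrite normr_ge0; apply: le_trans (normr_innerT_le _ _) _.
      by rewrite ler_wpM2r ?frobT_ge0.
    have := hdM t; rewrite /cvgT; under eq_fun do rewrite subr0.
    by move=> dM0; exact: cvg0Ml.
have r_lim t : cvgT (fun k => G t (phi1 k) - C (phi1 k).+1) 0.
  apply: (@cvg0_le _ _ (fun k => Num.sqrt (mu^-1 * r (phi1 k)))) => [k|].
    rewrite frobT_ge0 subr0 -[X in X <= _]ger0_norm ?frobT_ge0// -sqrtr_sqr.
    apply: ler_wsqrtr; rewrite /r mulKf ?gt_eqF// (bigD1 t)//= lerDl.
    by apply: sumr_ge0 => i _; exact: sqr_ge0.
  rewrite -[X in _ --> X]sqrtr0; apply: continuous_cvg; first exact: sqrt_continuous.
  exact: cvg0Ml.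
(* One finite family gathers all thirteen sequences, so that a single extraction
   makes them all converge. *)
pose z (j : option ('I_3 * 'I_4)) : nat -> tensor R W H L :=
  if j is Some (t, i) then nth C [:: G t; Hh t; M t; V t] i else C.
have [phi2 phi2_lt [l zl]] : exists2 phi : nat -> nat,
    {homo phi : i j / (i < j)%N} &
    exists l, forall j, cvgT (fun k => z j (phi1 (phi k)).+1) (l j).
  apply: (@boundedT_cvg_subseq _ _ _ _ _ (fun j k => z j (phi1 k).+1)) => j.
  have [K zK] : boundedT (z j) by case: j => [[t [[|[|[|[|i]]]] hi]]|] //=.
  by exists K => k.
pose psi k := phi1 (phi2 k).
have psi_lt : {homo psi : i j / (i < j)%N} by move=> i j ij; exact/phi1_lt/phi2_lt.
pose Cs := l None.
pose Gs t := l (Some (t, Ordinal (isT : 0 < 4)%N)).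
pose Hs t := l (Some (t, Ordinal (isT : 1 < 4)%N)).
pose Ms t := l (Some (t, Ordinal (isT : 2 < 4)%N)).
pose Vs t := l (Some (t, Ordinal (isT : 3 < 4)%N)).
have cC : cvgT (fun k => C (psi k).+1) Cs := zl None.
have cG t : cvgT (fun k => G t (psi k).+1) (Gs t) :=
  zl (Some (t, Ordinal (isT : 0 < 4)%N)).
have cH t : cvgT (fun k => Hh t (psi k).+1) (Hs t) :=
  zl (Some (t, Ordinal (isT : 1 < 4)%N)).
have cM t : cvgT (fun k => M t (psi k).+1) (Ms t) :=
  zl (Some (t, Ordinal (isT : 2 < 4)%N)).
have cV t : cvgT (fun k => V t (psi k).+1) (Vs t) :=
  zl (Some (t, Ordinal (isT : 3 < 4)%N)).
have cGC t : cvgT (fun k => G t (psi k) - C (psi k).+1) 0.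
  exact: (cvgT_subseq phi2_lt (r_lim t)).
(* Consecutive multipliers differ by o(1), hence have the same limit. *)
have cM' t : cvgT (fun k => M t (psi k)) (Ms t).
  have := cvgTB (cM t) (cvgT_subseq psi_lt (hdM t)); rewrite subr0.
  by under eq_fun do rewrite subKr.
have cV' t : cvgT (fun k => V t (psi k)) (Vs t).
  have := cvgTB (cV t) (cvgT_subseq psi_lt (hdV t)); rewrite subr0.
  by under eq_fun do rewrite subKr.
have GCs t : Gs t - Cs = 0.
  exact: cvgT_unique (cvgTB (cG t) cC) (cvgT_subseq psi_lt (GC0 t)).
have HGs t : Hs t - nabla t (Gs t) = 0.
  exact: cvgT_unique (cvgTB (cH t) (cvgT_nabla _ (cG t))) (cvgT_subseq psi_lt (HG0 t)).
have cG' t : cvgT (fun k => G t (psi k)) (Gs t).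
  have := cvgTD (cGC t) cC; rewrite add0r; under eq_fun do rewrite subrK.
  by rewrite (subr0_eq (GCs t)).
exists (fun k => (psi k).+1), Cs, Gs, Hs; split => //.
have mu2 : 2 * mu != 0 by rewrite gt_eqF// mulr_gt0.
exists Ms, Vs; split => //.
- pose A k := Rm^T *m (Rm *m unfold3 (C (psi k).+1) *m B *m Sm - unfold3 X)
        *m Sm^T *m B^T
      + Rm^T *m F^T *m (F *m Rm *m unfold3 (C (psi k).+1) - unfold3 Y)
      - mu *: \sum_(t < 3)
          unfold3 (G t (psi k) - C (psi k).+1 + (2 * mu)^-1 *: M t (psi k)).
  have A0 k : A k = 0.
    exact/esym/(argmin_data_fit (m := fun t => (2 * mu)^-1 *: M t (psi k)) (stepC (psi k))).
  have -> : 2^-1 *: \sum_(i < 3) unfold3 (Ms i) =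
      mu *: \sum_(i < 3) unfold3 (0 + (2 * mu)^-1 *: Ms i).
    rewrite !scaler_sumr; apply: eq_bigr => i _.
    rewrite add0r linearZ/= scalerA; congr (_ *: _); field; rewrite gt_eqF//.
  apply: (@cvg_entries_unique _ _ _ A).
    rewrite (_ : A = fun=> 0); last exact/funext.
    exact: cvg_entries_cst.
  have uC := cvg_entries_unfold3 cC.
  apply: cvg_entriesB; last first.
    apply: cvg_entriesZ; apply: cvg_entries_sum => t; apply: cvg_entries_unfold3.
    by apply: cvgTD => //; exact: cvgTZ.
  apply: cvg_entriesD; last first.
    apply: cvg_entries_mulmx; first exact: cvg_entries_cst.
    apply: cvg_entriesB; last exact: cvg_entries_cst.
    by apply: cvg_entries_mulmx => //; exact: cvg_entries_cst.
  do 2 (apply: cvg_entries_mulmx; last exact: cvg_entries_cst).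
  apply: cvg_entries_mulmx; first exact: cvg_entries_cst.
  apply: cvg_entriesB; last exact: cvg_entries_cst.
  do 2 (apply: cvg_entries_mulmx; last exact: cvg_entries_cst).
  by apply: cvg_entries_mulmx => //; exact: cvg_entries_cst.
- move=> t.
  have stepE (A D : tensor R W H L) : A + (2 * mu) *: D =
      (2 * mu) *: (D + (2 * mu)^-1 *: A).
    by rewrite scalerDr scalerA mulfV// scale1r addrC.
  have MV k : M t k.+1 = adjointT (nabla t) (V t k.+1).
    rewrite stepM stepV !stepE (argmin_nabla_fit hmu (stepG k t)).
    by apply/ffunP => x; rewrite !ffunE innerTZr.
  apply/esym/eqP; rewrite subr_eq0; apply/eqP.
  apply: cvgT_unique (cM t) _; under eq_fun do rewrite MV.
  exact: cvgT_adjointT.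
- move=> t.
  have [K K0 PhiK] := Phi_lipschitz L cl pix heps.
  pose P k := nabla t (G t (psi k)) - (2 * mu)^-1 *: V t (psi k).
  have subP Z k : Z - P k = Z - nabla t (G t (psi k)) + (2 * mu)^-1 *: V t (psi k).
    by rewrite /P opprB addrA addrAC.
  have Hmin k : is_argmin (fun Z => mu * frobT (Z - P k) ^+ 2
      + alpha t * Phi eps cl pix Z) (Hh t (psi k).+1).
    by move=> Z; rewrite !subP; exact: stepH.
  have HP : cvgT (fun k => (2 * mu) *: (Hh t (psi k).+1 - P k)) (Vs t).
    have -> : Vs t = (2 * mu) *: (Hs t - nabla t (Gs t) + (2 * mu)^-1 *: Vs t).
      by rewrite HGs add0r scalerA mulfV// scale1r.
    apply: cvgTZ; under eq_fun do rewrite subP.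
    by apply: cvgTD (cvgTZ _ (cV' t)); apply: cvgTB => //; exact: cvgT_nabla.
  have [xi Phi_xi xiV] := argmin_prox_limiting_subdiff K0 PhiK hmu (halpha t) Hmin (cH t) HP.
  by exists xi.
Qed.
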